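(* Let $a\in(0,\frac12)$, $\alpha=(2(1-2a))^{1/2}$, $\beta=(8a(1-2a))^{1/2}$, and let $$A(t,x)=e^{it}\left[1+\frac{\alpha^2\cosh(\beta t)+i\beta\sinh(\beta t)}{\sqrt{2a}\,\cos(\alpha x)-\cosh(\beta t)}\right],\qquad t,x\in\mathbb{R},$$ be the Akhmediev breather. Then $A$ is a critical point of the functional $$\mathcal{H}[u]:=F[u]-\alpha^2E[u],$$ that is, for each $t\in\mathbb{R}$, $\mathcal{H}'[A(t,\cdot)][w]=0$ for all $w\in H^2_\sharp$. In particular, for each $t\in\mathbb{R}$, $A=A(t,x)$ satisfies the nonlinear ODE (in $x$) $$A_{xxxx}+3A_x^2\bar A+(4|A|^2-3)A_{xx}+A^2\bar A_{xx}+2|A_x|^2A+\frac32(|A|^2-1)^2A+\alpha^2\big(A_{xx}+(|A|^2-1)A\big)=0.$$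
   Context: $H^2_\sharp=H^2_\sharp((0,\frac{2\pi}{\alpha}))$ is the standard Sobolev space $H^2$ of complex-valued $\frac{2\pi}{\alpha}$-periodic functions of $x$. For $u\in H^2_\sharp$, $$E[u]:=\int_0^{\frac{2\pi}{\alpha}}\Big(|u_x|^2-\frac12(|u|^2-1)^2\Big)\,dx,$$ $$F[u]:=\int_0^{\frac{2\pi}{\alpha}}\Big(|u_{xx}|^2-3(|u|^2-1)|u_x|^2-\frac12\big((|u|^2)_x\big)^2+\frac12(|u|^2-1)^3\Big)\,dx.$$ $\mathcal{H}'[A][w]$ denotes the first (real-linear) variation of $\mathcal{H}$ at $A$ in direction $w$, i.e. $\mathcal{H}[A+w]=\mathcal{H}[A]+\mathcal{H}'[A][w]+O(\|w\|_{H^2_\sharp}^2)$ for small $w$. *)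

(* Defs.v *)
From HB Require Import structures.
From mathcomp Require Import all_boot all_order all_algebra.
From mathcomp Require Import complex.
From mathcomp Require Import all_classical all_reals all_analysis.
Import Order.TTheory GRing.Theory Num.Theory numFieldNormedType.Exports.
Import ComplexField.

Set Implicit Arguments.
Unset Strict Implicit.
Unset Printing Implicit Defensive.

Local Open Scope classical_set_scope.
Local Open Scope complex_scope.
Local Open Scope ring_scope.

Section Complex.
Context {R : realType}.

Definition abs2 (z : R[i]) : R := complex.Re z ^+ 2 + complex.Im z ^+ 2.

(* R[i] carries no R-module structure (only its alias Rcomplex does), so
   derivatives and integrals of complex-valued functions of a real variable are
   taken componentwise. *)
Definition cderivable (u : R -> R[i]) (x : R) : Prop :=
  derivable (fun y => complex.Re (u y)) x 1 /\
  derivable (fun y => complex.Im (u y)) x 1.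

Definition cderive (u : R -> R[i]) (x : R) : R[i] :=
  derive1 (fun y => complex.Re (u y)) x +i* derive1 (fun y => complex.Im (u y)) x.

Definition rint (l : R) (f : R -> R) : R :=
  \int[lebesgue_measure]_(x in `[0, l]) f x.

Definition cint (l : R) (f : R -> R[i]) : R[i] :=
  rint l (fun x => complex.Re (f x)) +i* rint l (fun x => complex.Im (f x)).

End Complex.

Section PeriodicSobolev.
Context {R : realType}.
Variable l : R. (* the period *)
Implicit Types u v w : R -> R[i].

Definition L2per u : Prop :=
  [/\ forall x, u (x + l) = u x,
      measurable_fun setT (fun x => complex.Re (u x)),
      measurable_fun setT (fun x => complex.Im (u x)) &
      lebesgue_measure.-integrable `[0, l] (fun x => (abs2 (u x))%:E)].

Definition test_function (phi : R -> R) : Prop :=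
  (forall x, phi (x + l) = phi x) /\
  (forall n x, derivable (derive1n n phi) x 1).

Definition is_weak_derivative u v : Prop :=
  [/\ L2per u, L2per v &
      forall phi, test_function phi ->
        cint l (fun x => u x * (derive1 phi x)%:C)
        = - cint l (fun x => v x * (phi x)%:C)].

(* A weak derivative of u, unique up to equality almost everywhere
   (0 if there is none). *)
Definition wderive u : R -> R[i] :=
  xget (fun=> 0) [set v | is_weak_derivative u v].

(* Members are functions rather than classes modulo almost everywhere
   equality; all the quantities below are invariant under that equality. *)
Definition H2per u : Prop :=
  exists v w, is_weak_derivative u v /\ is_weak_derivative v w.

Definition H2norm u : R :=
  Num.sqrt (rint l (fun x =>
    abs2 (u x) + abs2 (wderive u x) + abs2 (wderive (wderive u) x))).

Definition energyE u : R :=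
  rint l (fun x => abs2 (wderive u x) - 2^-1 * (abs2 (u x) - 1) ^+ 2).

Definition energyF u : R :=
  let ux := wderive u in
  let uxx := wderive ux in
  let rhox := wderive (fun x => (abs2 (u x))%:C) in
  rint l (fun x =>
    abs2 (uxx x) - 3 * (abs2 (u x) - 1) * abs2 (ux x)
    - 2^-1 * complex.Re (rhox x) ^+ 2 + 2^-1 * (abs2 (u x) - 1) ^+ 3).

Definition real_linear_H2 (D : (R -> R[i]) -> R) : Prop :=
  forall (c : R) v w, H2per v -> H2per w ->
    D (fun x => c%:C * v x + w x) = c * D v + D w.

Definition is_first_variation
    (Phi : (R -> R[i]) -> R) u (D : (R -> R[i]) -> R) : Prop :=
  real_linear_H2 D /\
  exists C delta : R, 0 < delta /\
    forall w, H2per w -> H2norm w <= delta ->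
      `|Phi (fun x => u x + w x) - Phi u - D w| <= C * H2norm w ^+ 2.

Definition is_critical_point (Phi : (R -> R[i]) -> R) u : Prop :=
  [/\ H2per u,
      exists D, is_first_variation Phi u D &
      forall D, is_first_variation Phi u D -> forall w, H2per w -> D w = 0].

End PeriodicSobolev.

Section Akhmediev.
Context {R : realType}.

Definition cosh (x : R) : R := (expR x + expR (- x)) / 2.
Definition sinh (x : R) : R := (expR x - expR (- x)) / 2.

Definition breather (a alpha beta t x : R) : R[i] :=
  (cos t +i* sin t) *
  (1 + ((alpha ^+ 2 * cosh (beta * t)) +i* (beta * sinh (beta * t)))
       / (Num.sqrt (2 * a) * cos (alpha * x) - cosh (beta * t))%:C).

Definition calH (alpha : R) (u : R -> R[i]) : R :=
  let l := 2 * pi / alpha in energyF l u - alpha ^+ 2 * energyE l u.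

End Akhmediev.

(* Main.v *)
Require Import Defs.
From mathcomp Require Import all_boot all_order all_algebra.
From mathcomp Require Import complex.
From mathcomp Require Import all_classical all_reals all_analysis.
From mathcomp Require Import measurable_realfun.
From mathcomp Require Import ring lra.
Import Order.TTheory GRing.Theory Num.Theory numFieldNormedType.Exports.
Local Open Scope classical_set_scope.
Local Open Scope complex_scope.
Local Open Scope ring_scope.

Set Implicit Arguments.
Unset Strict Implicit.
Unset Printing Implicit Defensive.

(* Up to the phase exp(it), the breather is 1 + (M + iN) g with
   g = 1 / (sqrt(2a) cos(alpha x) - cosh(beta t)), and g satisfies
   g_x^2 = -(E/2) g^4 - 2M g^3 - alpha^2 g^2 with E = M^2 + N^2.  Differentiating
   this once gives g_xx, hence g_xxxx, as polynomials in g and g_x^2, and the ODE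
   becomes a polynomial identity.

   For the variational statement, H[A + w] - H[A] is the integral of a term linear
   in w and of a remainder.  The linear term integrates to zero: moving the weak
   derivatives onto the smooth coefficients leaves the ODE.  The remainder is
   bounded pointwise by C (|w|^2 + |w_x|^2 + |w_xx|^2) as soon as |w| <= 1, which
   the Sobolev embedding of H^1 into bounded functions ensures for small w.  So the
   zero functional is a first variation, and first variations are unique.

   The embedding and the Leibniz rule for weak derivatives come from the
   du Bois-Reymond lemma (a weakly differentiable function is almost everywhere a
   primitive of its weak derivative), which in turn rests on the completeness of
   trigonometric polynomials. *)

(** * Integrals over [0, l] *)

(** Two features of the setting shape the proof. [wderive] picks an arbitrary weak derivative, so an
    integral involving it can only be computed after a transfer, along almost everywhere equality,
    to explicit representatives; uniqueness of weak derivatives therefore precedes any statement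
    about the energies. Moreover weak derivatives are tested against smooth periodic functions only,
    so completeness has to be proved inside that class. Trigonometric polynomials serve because they
    are stable under differentiation and, up to a constant, under taking primitives. The bound |w|
    <= 1 is enough for the remainder because w_x and w_xx enter the densities at most quadratically.
    The equation for g_x^2 comes from kappa cos(alpha x) = 1/g + cosh(beta t), with kappa =
    sqrt(2a), substituted into sin^2 + cos^2 = 1; the values of alpha and beta are what makes the
    coefficient of g^4 equal to -E/2. *)

Section RealIntegral.
Context {R : realType}.
Local Notation mu := (@lebesgue_measure R).
Implicit Types (l k x y : R) (f g p q : R -> R).

Definition L1 l f := mu.-integrable `[0, l] (EFin \o f).

Definition ae_on l (P : R -> Prop) := {ae mu, forall x, 0 <= x <= l -> P x}.

Lemma ae_on_and l (P Q : R -> Prop) :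
  ae_on l P -> ae_on l Q -> ae_on l (fun x => P x /\ Q x).
Proof.
rewrite /ae_on => hP hQ; apply: filterS2 hP hQ.
  exact: (ae_filter_ringOfSetsType mu).
by move=> x hp hq xl; split; [exact: hp|exact: hq].
Qed.

Lemma ae_on_imp l (P Q : R -> Prop) :
  (forall x, 0 <= x <= l -> P x -> Q x) -> ae_on l P -> ae_on l Q.
Proof.
rewrite /ae_on => h; apply: filterS; first exact: (ae_filter_ringOfSetsType mu).
by move=> x hP xl; exact: h (hP xl).
Qed.

Lemma ae_onW l (P : R -> Prop) : (forall x, 0 <= x <= l -> P x) -> ae_on l P.
Proof. by move=> h; apply: aeW. Qed.

Lemma L1_measurable l f : L1 l f -> measurable_fun `[0, l] f.
Proof. by move=> /measurable_int /measurable_EFinP. Qed.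

Lemma L1S l k f : k <= l -> L1 l f -> L1 k f.
Proof.
move=> kl; apply: integrableS; [exact: measurable_itv..|].
by apply: subset_itvl; rewrite bnd_simp.
Qed.

Lemma L1D l f g : L1 l f -> L1 l g -> L1 l (fun x => f x + g x).
Proof. by move=> hf hg; apply: integrableD hf hg; exact: measurable_itv. Qed.

Lemma L1Z l c f : L1 l f -> L1 l (fun x => c * f x).
Proof. by move=> hf; exact: (integrableZl _ c hf). Qed.

Lemma L1N l f : L1 l f -> L1 l (fun x => - f x).
Proof. by move=> hf; exact: (integrableN hf). Qed.

Lemma L1B l f g : L1 l f -> L1 l g -> L1 l (fun x => f x - g x).
Proof. by move=> hf hg; apply: L1D => //; exact: L1N. Qed.

Lemma L1_cst l c : L1 l (fun=> c).
Proof.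
apply: (@measurable_bounded_integrable _ _ _ mu (fun=> c)) => //.
  by rewrite /= lebesgue_measure_itv /=; case: ifP => // _; rewrite ltry.
by exists `|c|; split => // M cM x _ /=; exact: ltW.
Qed.

Lemma L1_norm l f : L1 l f -> L1 l (fun x => `|f x|).
Proof. by move=> hf; exact: (integrable_norm hf). Qed.

Lemma L1_le l f g : measurable_fun `[0, l] f -> L1 l g ->
  (forall x, 0 <= x <= l -> `|f x| <= g x) -> L1 l f.
Proof.
move=> mf hg h; apply: (le_integrable _ _ _ hg) => //.
  by apply/measurable_EFinP.
by move=> x xl /=; rewrite lee_fin (le_trans (h x xl))// ler_norm.
Qed.

Lemma L1M_bounded l f g M : L1 l f -> measurable_fun `[0, l] g ->
  (forall x, 0 <= x <= l -> `|g x| <= M) -> L1 l (fun x => f x * g x).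
Proof.
move=> hf mg h; apply: (@L1_le _ _ (fun x => M * `|f x|)).
- by apply: measurable_funM => //; exact: L1_measurable.
- by apply: L1Z; exact: L1_norm.
- by move=> x xl; rewrite normrM mulrC ler_wpM2r// h.
Qed.

Lemma eq_rint l f g : (forall x, 0 <= x <= l -> f x = g x) -> rint l f = rint l g.
Proof.
by move=> h; apply: eq_Rintegral => x /set_mem /=; rewrite in_itv/=; exact: h.
Qed.

Lemma rint_ae l f g : measurable_fun `[0, l] f -> measurable_fun `[0, l] g ->
  ae_on l (fun x => f x = g x) -> rint l f = rint l g.
Proof.
move=> mf mg fg; rewrite /rint /Rintegral; congr fine.
apply: ae_eq_integral => //; [exact/measurable_EFinP|exact/measurable_EFinP|].
by apply: (ae_on_imp _ fg) => x _ ->.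
Qed.

Lemma rintD l f g : L1 l f -> L1 l g ->
  rint l (fun x => f x + g x) = rint l f + rint l g.
Proof. by move=> hf hg; rewrite /rint RintegralD. Qed.

Lemma rintZ l c f : L1 l f -> rint l (fun x => c * f x) = c * rint l f.
Proof. by move=> hf; rewrite /rint RintegralZl. Qed.

Lemma rintN l f : L1 l f -> rint l (fun x => - f x) = - rint l f.
Proof.
by move=> hf; rewrite -mulN1r -rintZ//; apply: eq_rint => x _; rewrite mulN1r.
Qed.

Lemma rintB l f g : L1 l f -> L1 l g ->
  rint l (fun x => f x - g x) = rint l f - rint l g.
Proof. by move=> hf hg; rewrite rintD ?rintN//; exact: L1N. Qed.

Lemma rint_cst l c : 0 <= l -> rint l (fun=> c) = c * l.
Proof.
move=> l0; rewrite /rint Rintegral_cst; last exact: measurable_itv.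
rewrite [X in fine X](_ : _ = l%:E)// [LHS]lebesgue_measure_itv/= lte_fin.
by move: l0; rewrite le_eqVlt => /predU1P[<-|->]; rewrite ?ltxx// oppr0 addr0.
Qed.

Lemma le_rint l f g : L1 l f -> L1 l g ->
  (forall x, 0 <= x <= l -> f x <= g x) -> rint l f <= rint l g.
Proof. by move=> hf hg h; apply: le_Rintegral. Qed.

Lemma rint_ge0 l f : (forall x, 0 <= x <= l -> 0 <= f x) -> 0 <= rint l f.
Proof. by move=> h; apply: Rintegral_ge0. Qed.

Lemma ler_norm_rint l f : L1 l f -> `|rint l f| <= rint l (fun x => `|f x|).
Proof. by move=> hf; apply: le_normr_Rintegral. Qed.

Lemma rint0 f : rint 0 f = 0.
Proof. by rewrite /rint set_itv1 Rintegral_set1. Qed.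

Lemma rintS l f k : L1 l f -> 0 <= k <= l ->
  rint l f = rint k f + \int[mu]_(x in `]k, l]) f x.
Proof.
move=> hf /andP[k0 kl].
by rewrite -(@Rintegral_itvB _ f (BLeft 0) (BRight l) k hf) ?bnd_simp// /rint addrC subrK.
Qed.

Lemma rint_measurable l f : 0 <= l -> L1 l f ->
  measurable_fun `[0, l] (fun x => rint x f).
Proof.
move=> l0 hf; apply: subspace_continuous_measurable_fun; first exact: measurable_itv.
exact: (parameterized_integral_continuous l0 hf).
Qed.

Lemma le_rint_itv l f k : L1 l f -> 0 <= k <= l -> `|rint k f| <= rint l (fun x => `|f x|).
Proof.
move=> hf /andP[k0 kl]; apply: le_trans (ler_norm_rint (L1S kl hf)) _.
rewrite (rintS (L1_norm hf) (_ : 0 <= k <= l)) ?k0// lerDl.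
by apply: Rintegral_ge0.
Qed.

Local Notation GR := (measurableTypeR R).

Lemma L1_integrableT l f : L1 l f ->
  mu.-integrable setT (EFin \o (f \_ `[0, l])).
Proof.
move=> hf; rewrite -restrict_EFin.
by apply/integrable_restrict => //; rewrite setTI.
Qed.

Lemma measurable_fun_triangle :
  measurable_fun [set: GR * GR] (fun z : GR * GR => \1_[set z : R * R | z.2 <= z.1] z : R).
Proof.
apply: measurable_indic.
pose f21 (z : GR * GR) := (z.2 <= z.1)%R.
have : measurable_fun setT f21 by exact: measurable_fun_ler.
by move=> /(_ measurableT [set true]); rewrite setTI; exact.
Qed.

Lemma EFin_Rintegral (D : set GR) f : measurable D -> mu.-integrable D (EFin \o f) ->
  (\int[mu]_(x in D) (f x)%:E = (\int[mu]_(x in D) f x)%R%:E)%E.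
Proof. by move=> mD hf; rewrite /Rintegral fineK//; exact: integrable_fin_num. Qed.

Lemma rintE l f : L1 l f -> (\int[mu]_(x in `[0%R, l]) (f x)%:E = (rint l f)%:E)%E.
Proof. by move=> hf; apply: EFin_Rintegral. Qed.

Lemma integralZ_restrict c (D : set GR) f : measurable D ->
  mu.-integrable D (EFin \o f) ->
  (\int[mu]_y (c * (f \_ D) y)%:E = (c * (\int[mu]_(y in D) f y))%R%:E)%E.
Proof.
move=> mD hf; under eq_integral do rewrite EFinM.
have h : mu.-integrable setT (EFin \o (f \_ D)).
  by rewrite -restrict_EFin; apply/integrable_restrict => //; rewrite setTI.
rewrite integralZl// EFinM; congr (_ * _)%E.
by rewrite -EFin_Rintegral// [in RHS]integral_mkcond restrict_EFin.
Qed.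

Lemma mem_segment (a b x : R) : (x \in [set` `[a, b]]) = (a <= x <= b).
Proof. by rewrite mem_setE in_itv. Qed.

(* Both iterated integrals run over the triangle [0 <= y <= x <= l]. *)
Lemma rint_triangle l p q : L1 l p -> L1 l q ->
  rint l (fun x => p x * rint x q) =
  rint l (fun y => (\int[mu]_(x in `[y, l]) p x) * q y).
Proof.
move=> hp hq.
pose D : set GR := [set` `[0, l]].
pose P : GR -> R := p \_ D; pose Q : GR -> R := q \_ D.
have iP : mu.-integrable setT (EFin \o P) by exact: L1_integrableT.
have iQ : mu.-integrable setT (EFin \o Q) by exact: L1_integrableT.
have mP : measurable_fun setT P by move/measurable_int : iP => /measurable_EFinP.
have mQ : measurable_fun setT Q by move/measurable_int : iQ => /measurable_EFinP.
pose T := [set z : R * R | z.2 <= z.1].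
pose F (z : GR * GR) : R := P z.1 * Q z.2 * \1_T z.
have mPQ : measurable_fun setT (fun z : GR * GR => P z.1 * Q z.2).
  by apply: measurable_funM; apply: measurableT_comp.
have mF : measurable_fun setT F.
  by apply: measurable_funM => //; exact: measurable_fun_triangle.
(* By Tonelli the double integral of [|P| |Q|] factors into two finite ones; this product then
   dominates [F], whose extra factor is an indicator. *)
have iPQ : (mu \x mu)%E.-integrable setT (fun z : GR * GR => (P z.1 * Q z.2)%:E).
  apply/integrable12ltyP; first exact/measurable_EFinP.
  rewrite /=.
  under eq_integral => x _.
    under eq_integral do rewrite normrM EFinM.
    rewrite ge0_integralZl//; last first.
      by apply/measurable_EFinP; exact: measurableT_comp.
    rewrite muleC.
    over.
  rewrite ge0_integralZl//; last 2 first.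
  - by apply/measurable_EFinP; exact: measurableT_comp.
  - by apply: integral_ge0.
  move: iP iQ => /integrableP[_ iP] /integrableP[_ iQ].
  by apply: lte_mul_pinfty; rewrite ?ge0_fin_numE ?integral_ge0.
have iF : (mu \x mu)%E.-integrable setT (EFin \o F).
  apply: le_integrable iPQ => //; first exact/measurable_EFinP.
  move=> z _; rewrite lee_fin/F normrM -[leRHS]mulr1 ler_wpM2l//.
  by rewrite /T indicE; case: (_ \in _); rewrite ?normr1 ?normr0.
have := Fubini iF.
rewrite (_ : (\int[mu]_x _)%E = (\int[mu]_(x in D) (p x * rint x q)%:E)%E); last first.
  rewrite [RHS]integral_mkcond; apply: eq_integral => x _ /=; rewrite patchE.
  have [xD|xD] := boolP (x \in D); last first.
    apply: integral0_eq => y _; rewrite /F/=/P patchE (negbTE xD).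
    by rewrite !mul0r.
  move: (xD); rewrite [_ \in _]mem_segment => /andP[x0 xl].
  rewrite -integralZ_restrict//; last exact: L1S hq.
  apply: eq_integral => y _; rewrite /F/=/P patchE xD -mulrA; congr (_ * _)%:E.
  rewrite /Q indicE !patchE /T/D !mem_segment.
  rewrite (_ : (_ \in _) = (y <= x)); last by apply/idP/idP; rewrite inE.
  have [yx|yx] := leP y x; last by rewrite andbF mulr0.
  by rewrite (le_trans yx xl) mulr1.
rewrite (_ : (\int[mu]_y _)%E =
  (\int[mu]_(y in D) ((\int[mu]_(x in `[y, l]) p x)%R * q y)%:E)%E); last first.
  rewrite [RHS]integral_mkcond; apply: eq_integral => y _ /=; rewrite patchE.
  have [yD|yD] := boolP (y \in D); last first.
    apply: integral0_eq => x _; rewrite /F/=/Q (patchE _ D y) (negbTE yD).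
    by rewrite mulr0 mul0r.
  move: (yD); rewrite [_ \in _]mem_segment => /andP[y0 yl].
  rewrite mulrC -integralZ_restrict//; last first.
    by apply: integrableS hp => //; apply: subset_itvr; rewrite bnd_simp.
  apply: eq_integral => x _; rewrite /F/=/Q (patchE _ D y) yD.
  rewrite (mulrC (P x)) -mulrA; congr (_ * _)%:E.
  rewrite /P indicE !patchE /T/D !mem_segment.
  rewrite (_ : (_ \in _) = (y <= x)); last by apply/idP/idP; rewrite inE.
  have [yx|yx] := leP y x; last by rewrite mulr0.
  by rewrite (le_trans y0 yx) mulr1.
by move=> h; rewrite /rint/Rintegral h.
Qed.

(** Exchanging the order of integration turns the first term into the integral of [q y] times the
    mass of [p] on [[y, l]]; the second term supplies the mass on [[0, y]]. Primitives are never
    differentiated. *)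
Lemma rint_by_parts l p q : 0 <= l -> L1 l p -> L1 l q ->
  rint l (fun x => p x * rint x q + rint x p * q x) = rint l p * rint l q.
Proof.
move=> l0 hp hq.
have mp := rint_measurable l0 hp; have mq := rint_measurable l0 hq.
have hpq : L1 l (fun x => p x * rint x q).
  by apply: L1M_bounded hp mq _ => x xl; exact: le_rint_itv hq xl.
have hqp : L1 l (fun x => rint x p * q x).
  under eq_fun do rewrite mulrC.
  by apply: L1M_bounded hq mp _ => x xl; exact: le_rint_itv hp xl.
rewrite rintD// rint_triangle//.
rewrite (@eq_rint _ _ (fun y => rint l p * q y - rint y p * q y)); last first.
  move=> x /andP[x0 xl]; rewrite -mulrBl; congr (_ * _).
  rewrite (rintS hp (_ : 0 <= x <= l)) ?x0// addrC addKr Rintegral_itv_obnd_cbnd//.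
  by apply: integrableS hp => //; apply: subset_itv; rewrite bnd_simp.
by rewrite rintB ?subrK ?rintZ//; exact: L1Z.
Qed.

(** Absolute continuity in integrated form: the density [p] is part of the data, and [P] is not
    asked to be differentiable at any point. *)
Definition abs_cont l (P p : R -> R) := L1 l p /\ forall x, 0 <= x <= l -> P x = P 0 + rint x p.

Lemma abs_cont_measurable l P p : 0 <= l -> abs_cont l P p -> measurable_fun `[0, l] P.
Proof.
move=> l0 [hp hP].
apply: (eq_measurable_fun (fun x => P 0 + rint x p)).
  by move=> x; rewrite mem_segment => /hP.
by apply: measurable_funD => //; exact: rint_measurable.
Qed.

Lemma abs_cont_bounded l P p x : abs_cont l P p -> 0 <= x <= l ->
  `|P x| <= `|P 0| + rint l (fun x => `|p x|).
Proof.
move=> [hp hP] xl; rewrite hP// (le_trans (ler_normD _ _))// lerD2l.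
exact: le_rint_itv.
Qed.

Lemma abs_cont_L1M l P p f : 0 <= l -> abs_cont l P p -> L1 l f -> L1 l (fun x => f x * P x).
Proof.
move=> l0 hP hf; apply: L1M_bounded hf (abs_cont_measurable l0 hP) _.
by move=> x xl; exact: (abs_cont_bounded hP xl).
Qed.

Lemma abs_cont_L1 l P p : 0 <= l -> abs_cont l P p -> L1 l P.
Proof.
move=> l0 hP; have := abs_cont_L1M l0 hP (L1_cst l 1).
by under eq_fun do rewrite mul1r.
Qed.

(** Writing each factor as its value at 0 plus a primitive, the constants contribute linear terms
    and the product of the primitives is [rint_by_parts] on [[0, x]]. *)
Lemma abs_cont_mul l P p Q q : 0 <= l -> abs_cont l P p -> abs_cont l Q q ->
  abs_cont l (fun x => P x * Q x) (fun x => p x * Q x + P x * q x).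
Proof.
move=> l0 aP aQ; have [hp hP] := aP; have [hq hQ] := aQ.
have hpQ := abs_cont_L1M l0 aQ hp; have hPq := abs_cont_L1M l0 aP hq.
split; first by apply: L1D => //; under eq_fun do rewrite mulrC.
move=> x /andP[x0 xl].
have hx y : 0 <= y <= x -> 0 <= y <= l.
  by move=> /andP[-> yx]; rewrite (le_trans yx).
have [hpx hqx] := (L1S xl hp, L1S xl hq).
have hpqx : L1 x (fun y => p y * rint y q).
  by apply: L1M_bounded hpx (rint_measurable x0 hqx) _ => y; exact: le_rint_itv.
have hqpx : L1 x (fun y => rint y p * q y).
  under eq_fun do rewrite mulrC.
  by apply: L1M_bounded hqx (rint_measurable x0 hpx) _ => y; exact: le_rint_itv.
rewrite (@eq_rint _ _ (fun y => (Q 0 * p y + P 0 * q y) +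
  (p y * rint y q + rint y p * q y))); last first.
  by move=> y /hx yl; rewrite hP// (hQ y)//; ring.
rewrite rintD; [|by apply: L1D; exact: L1Z|exact: L1D].
rewrite rint_by_parts// rintD ?rintZ//; [|exact: L1Z..].
by rewrite hP ?x0// (hQ x) ?x0//; ring.
Qed.

Lemma abs_cont_C1 l f : (forall x, derivable f x 1) -> continuous (derive1 f) ->
  abs_cont l f (derive1 f).
Proof.
move=> df cf; split.
  by apply: continuous_compact_integrable; [exact: segment_compact|exact: continuous_subspaceT].
move=> x /andP[+ xl]; rewrite le_eqVlt => /predU1P[<-|x0]; first by rewrite rint0 addr0.
have cF : continuous f by move=> y; apply: differentiable_continuous; apply/derivable1_diffP.
have h := @continuous_FTC2 R (derive1 f) f 0 x x0.
rewrite /rint/Rintegral h/=.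
- ring.
- exact: continuous_subspaceT.
- split=> //; first exact/cvg_at_right_filter/cF.
  exact/cvg_at_left_filter/cF.
- by [].
Qed.

End RealIntegral.

(** * Derivatives and trigonometric polynomials *)

Section Derivatives.
Context {R : realType}.
Implicit Types (f g df dg : R -> R) (x : R).

Definition has_deriv (f df : R -> R) := forall x : R, is_derive x 1 f (df x).

Lemma has_deriv_derivable f df x : has_deriv f df -> derivable f x 1.
Proof. by move=> /(_ x) []. Qed.

Lemma has_deriv_derive1 f df : has_deriv f df -> derive1 f = df.
Proof. by move=> h; apply/funext => x; rewrite derive1E; case: (h x). Qed.

Lemma has_deriv_continuous f df : has_deriv f df -> continuous f.
Proof.
by move=> h y; apply: differentiable_continuous; apply/derivable1_diffP; case: (h y).
Qed.

Lemma has_deriv_eq f df dg : (forall x, df x = dg x) -> has_deriv f df ->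
  has_deriv f dg.
Proof. by move=> /funext <-. Qed.

Lemma has_deriv_cst c : has_deriv (fun=> c) (fun=> 0).
Proof. by move=> x; exact: is_derive_cst. Qed.

Lemma has_deriv_add f df g dg : has_deriv f df -> has_deriv g dg ->
  has_deriv (fun x => f x + g x) (fun x => df x + dg x).
Proof. by move=> hf hg x; exact: (is_deriveD (hf x) (hg x)). Qed.

Lemma has_deriv_mul f df g dg : has_deriv f df -> has_deriv g dg ->
  has_deriv (fun x => f x * g x) (fun x => df x * g x + f x * dg x).
Proof.
move=> hf hg x; have := is_deriveM (hf x) (hg x).
by move/is_derive_eq; apply; rewrite /= addrC mulrC.
Qed.

Lemma has_deriv_scale c f df : has_deriv f df ->
  has_deriv (fun x => c * f x) (fun x => c * df x).
Proof.
move=> hf; apply: has_deriv_eq (has_deriv_mul (has_deriv_cst c) hf) => x.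
by rewrite mul0r add0r.
Qed.

Lemma has_deriv_comp f df g dg : has_deriv f df -> has_deriv g dg ->
  has_deriv (fun x => f (g x)) (fun x => df (g x) * dg x).
Proof. by move=> hf hg x; exact: (is_derive1_comp (hf (g x)) (hg x)). Qed.

Lemma has_deriv_linear c : has_deriv (fun x => c * x) (fun=> c).
Proof.
apply: has_deriv_eq (has_deriv_scale c (fun x => is_derive_id x 1)) => x.
by rewrite mulr1.
Qed.

Lemma has_deriv_cos c : has_deriv (fun x => cos (c * x)) (fun x => - c * sin (c * x)).
Proof.
apply: has_deriv_eq (has_deriv_comp (@is_derive_cos R) (has_deriv_linear c)) => x.
by rewrite mulrC mulrN mulNr.
Qed.

Lemma has_deriv_sin c : has_deriv (fun x => sin (c * x)) (fun x => c * cos (c * x)).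
Proof.
apply: has_deriv_eq (has_deriv_comp (@is_derive_sin R) (has_deriv_linear c)) => x.
by rewrite mulrC.
Qed.

Lemma has_deriv_inv f df : (forall x, f x != 0) -> has_deriv f df ->
  has_deriv (fun x => (f x)^-1) (fun x => - df x * (f x)^-1 ^+ 2).
Proof.
move=> f0 hf x; have := is_deriveV (f0 x) (hf x).
by move/is_derive_eq; apply; rewrite /GRing.scale/= exprVn !mulNr mulrC.
Qed.

(** Reduces a condition on all iterated derivatives to a single differentiation inside a class [C];
    the classes used are trigonometric polynomials and [test_algebra]. *)
Lemma smooth_of_closed (C : (R -> R) -> Prop) :
  (forall f, C f -> exists2 df, C df & has_deriv f df) ->
  forall f, C f -> forall n x, derivable (derive1n n f) x 1.
Proof.
move=> hC f Cf n x.
have : C (derive1n n f).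
  elim: n => [//|n IH]; rewrite derive1nS.
  by have [df Cdf /has_deriv_derive1 ->] := hC _ IH.
by move=> /hC[df _ h]; exact: has_deriv_derivable h.
Qed.

End Derivatives.

Section TrigonometricPolynomials.
Context {R : realType}.
Variables (l w : R).
Hypothesis wl : w * l = pi *+ 2.
Implicit Types (f g : R -> R) (x : R).

(** Only a linear span, so that derivatives and primitives are taken term by term; the products that
    are needed come from the addition formulas. *)
Inductive trigpoly : (R -> R) -> Prop :=
| trig_cos n : trigpoly (fun x => cos (n%:R * w * x))
| trig_sin n : trigpoly (fun x => sin (n%:R * w * x))
| trig_add f g : trigpoly f -> trigpoly g -> trigpoly (fun x => f x + g x)
| trig_scale c f : trigpoly f -> trigpoly (fun x => c * f x).

Lemma trig_eq f g : (forall x, g x = f x) -> trigpoly f -> trigpoly g.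
Proof. by move=> /funext ->. Qed.

Lemma trig_cst c : trigpoly (fun=> c).
Proof.
apply: trig_eq (trig_scale c (trig_cos 0)) => x.
by rewrite !mul0r cos0 mulr1.
Qed.

(** Product-to-sum formulas. Frequency 0 is separate because the index [n - 1] would leave the
    natural numbers. *)
Lemma trig_cosM f : trigpoly f -> trigpoly (fun x => cos (w * x) * f x).
Proof.
elim=> [n|n|{}f g _ hf _ hg|c {}f _ hf].
- case: n => [|n].
    by apply: trig_eq (trig_cos 1) => x; rewrite !mul0r cos0 mulr1 mul1r.
  apply: trig_eq (trig_scale 2^-1 (trig_add (trig_cos n.+2) (trig_cos n))) => x.
  rewrite (_ : n.+2%:R * w * x = n.+1%:R * w * x + w * x); last by ring.
  rewrite (_ : n%:R * w * x = n.+1%:R * w * x - w * x); last by ring.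
  by rewrite cosB cosD; field.
- case: n => [|n].
    by apply: trig_eq (trig_cst 0) => x; rewrite !mul0r sin0 mulr0.
  apply: trig_eq (trig_scale 2^-1 (trig_add (trig_sin n.+2) (trig_sin n))) => x.
  rewrite (_ : n.+2%:R * w * x = n.+1%:R * w * x + w * x); last by ring.
  rewrite (_ : n%:R * w * x = n.+1%:R * w * x - w * x); last by ring.
  by rewrite sinB sinD; field.
- by apply: trig_eq (trig_add hf hg) => x; rewrite mulrDr.
- by apply: trig_eq (trig_scale c hf) => x; rewrite mulrCA.
Qed.

Lemma trig_sinM f : trigpoly f -> trigpoly (fun x => sin (w * x) * f x).
Proof.
elim=> [n|n|{}f g _ hf _ hg|c {}f _ hf].
- case: n => [|n].
    by apply: trig_eq (trig_sin 1) => x; rewrite !mul0r cos0 mulr1 mul1r.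
  apply: trig_eq (trig_scale 2^-1
    (trig_add (trig_sin n.+2) (trig_scale (-1) (trig_sin n)))) => x.
  rewrite (_ : n.+2%:R * w * x = n.+1%:R * w * x + w * x); last by ring.
  rewrite (_ : n%:R * w * x = n.+1%:R * w * x - w * x); last by ring.
  by rewrite sinB sinD; field.
- case: n => [|n].
    by apply: trig_eq (trig_cst 0) => x; rewrite !mul0r sin0 mulr0.
  apply: trig_eq (trig_scale 2^-1
    (trig_add (trig_cos n) (trig_scale (-1) (trig_cos n.+2)))) => x.
  rewrite (_ : n.+2%:R * w * x = n.+1%:R * w * x + w * x); last by ring.
  rewrite (_ : n%:R * w * x = n.+1%:R * w * x - w * x); last by ring.
  by rewrite cosB cosD; field.
- by apply: trig_eq (trig_add hf hg) => x; rewrite mulrDr.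
- by apply: trig_eq (trig_scale c hf) => x; rewrite mulrCA.
Qed.

(** Horner's scheme multiplies by [a + r * cos (w * (x - c))] at each step, and expanding the
    shifted cosine leaves multiplications by [cos (w * x)] and [sin (w * x)] only. *)
Lemma trig_horner (p : {poly R}) a r c :
  trigpoly (fun x => p.[a + r * cos (w * (x - c))]).
Proof.
elim/poly_ind: p => [|p b hp].
  by apply: trig_eq (trig_cst 0) => x; rewrite horner0.
pose A := trig_scale (r * cos (w * c)) (trig_cosM hp).
pose B := trig_scale (r * sin (w * c)) (trig_sinM hp).
apply: trig_eq (trig_add (trig_cst b) (trig_add (trig_scale a hp) (trig_add A B))) => x.
by rewrite hornerMXaddC mulrBr cosB; ring.
Qed.

Lemma trig_deriv f : trigpoly f -> exists2 f', trigpoly f' & has_deriv f f'.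
Proof.
elim=> [n|n|{}f g _ [f' tf hf] _ [g' tg hg]|c {}f _ [f' tf hf]].
- by eexists; [exact: (trig_scale (- (n%:R * w)) (trig_sin n))|exact: has_deriv_cos].
- by eexists; [exact: (trig_scale (n%:R * w) (trig_cos n))|exact: has_deriv_sin].
- by eexists; [exact: trig_add tf tg|exact: has_deriv_add].
- by eexists; [exact: trig_scale tf|exact: has_deriv_scale].
Qed.

Lemma trig_periodic f x : trigpoly f -> f (x + l) = f x.
Proof.
have h n : n%:R * w * (x + l) = n%:R * w * x + (pi *+ 2) *+ n.
  by rewrite mulrDr -mulrA -mulrA wl [n%:R * (pi *+ 2)]mulr_natl mulrA.
elim=> [n|n|{}f g _ hf _ hg|c {}f _ hf]; rewrite ?hf ?hg//.
- by rewrite h (periodicn (@cosD2pi R)).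
- by rewrite h (periodicn (@sinD2pi R)).
Qed.

Lemma trig_test f : trigpoly f -> test_function l f.
Proof.
move=> tf; split; first by move=> x; exact: trig_periodic.
exact: smooth_of_closed trig_deriv _ tf.
Qed.

Lemma trig_continuous f : trigpoly f -> continuous f.
Proof. by move=> /trig_deriv[f' _ h]; exact: has_deriv_continuous h. Qed.

Hypothesis w0 : w != 0.

(** The mean [c] is split off because a nonzero constant has no periodic primitive. *)
Lemma trig_antideriv f : trigpoly f ->
  exists c g g', [/\ trigpoly g, has_deriv g g' & forall x, f x = c + g' x].
Proof.
elim=> [n|n|{}f g _ [c [F [F' [tF dF hF]]]] _ [d [G [G' [tG dG hG]]]]
       |b {}f _ [c [F [F' [tF dF hF]]]]].
- case: n => [|n].
    exists 1, (fun=> 0), (fun=> 0); split; [exact: trig_cst|exact: has_deriv_cst|].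
    by move=> x; rewrite !mul0r cos0 addr0.
  exists 0; exists (fun x => (n.+1%:R * w)^-1 * sin (n.+1%:R * w * x)).
  eexists; split; [exact: trig_scale (trig_sin _)|exact: has_deriv_scale (has_deriv_sin _)|].
  by move=> x /=; rewrite add0r mulrA mulVf ?mul1r// mulf_neq0// pnatr_eq0.
- case: n => [|n].
    exists 0, (fun=> 0), (fun=> 0); split; [exact: trig_cst|exact: has_deriv_cst|].
    by move=> x; rewrite !mul0r sin0 addr0.
  exists 0; exists (fun x => (- (n.+1%:R * w))^-1 * cos (n.+1%:R * w * x)).
  eexists; split; [exact: trig_scale (trig_cos _)|exact: has_deriv_scale (has_deriv_cos _)|].
  by move=> x /=; rewrite add0r mulrA mulVf ?mul1r// oppr_eq0 mulf_neq0// pnatr_eq0.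
- exists (c + d); eexists; eexists; split; [exact: trig_add tF tG|exact: has_deriv_add dF dG|].
  by move=> x /=; rewrite hF hG addrACA.
- exists (b * c); eexists; eexists; split; [exact: trig_scale tF|exact: has_deriv_scale dF|].
  by move=> x /=; rewrite hF mulrDr.
Qed.

End TrigonometricPolynomials.

(** * Polynomials approximating a step at 1/2 *)

Section StepPolynomials.
Context {R : realType}.
Implicit Types (n : nat) (y : R).

(** The polynomials of Brosowski and Deutsch's proof of the Stone-Weierstrass theorem. The threshold
    is 1/2 because Bernoulli's inequality compares [(1 - y ^+ n) ^+ (2 ^ n)] with
    [2 ^ n * y ^ n = (2 * y) ^ n]: the distance to the limit is at most [(2 * y) ^ n] below 1/2 and
    [(2 * y) ^ (- n)] above it. *)
Definition step_poly n : {poly R} := 1 - (1 - 'X^n) ^+ (2 ^ n).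

Lemma step_polyE n y : (step_poly n).[y] = 1 - (1 - y ^+ n) ^+ (2 ^ n).
Proof. by rewrite /step_poly !hornerE. Qed.

Lemma step_poly_bounded n y : 0 <= y <= 1 -> 0 <= (step_poly n).[y] <= 1.
Proof.
move=> /andP[y0 y1]; rewrite step_polyE.
have t0 : 0 <= 1 - y ^+ n by rewrite subr_ge0 exprn_ile1.
by rewrite subr_ge0 exprn_ile1 ?gerBl ?exprn_ge0.
Qed.

Lemma bernoulli_lower (t : R) m : 0 <= t <= 1 -> 1 - m%:R * t <= (1 - t) ^+ m.
Proof.
move=> /andP[t0 t1]; elim: m => [|m IH]; first by rewrite mul0r subr0.
rewrite exprS (le_trans _ (ler_wpM2l _ IH)) ?subr_ge0// -subr_ge0 -natr1.
rewrite (_ : _ - _ = m%:R * t ^+ 2); last by ring.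
by rewrite mulr_ge0 ?sqr_ge0.
Qed.

(** Since [m t <= (1 + t)^m], the left side is at most [(1 - t^2)^m]. *)
Lemma bernoulli_upper (t : R) m : 0 <= t <= 1 -> m%:R * t * (1 - t) ^+ m <= 1.
Proof.
move=> /andP[t0 t1].
have h : m%:R * t <= (1 + t) ^+ m.
  elim: m => [|m IH]; first by rewrite mul0r.
  have h1 : 1 <= (1 + t) ^+ m by rewrite exprn_ege1// lerDl.
  by rewrite exprS mulrDl mul1r -natr1 mulrDl mul1r lerD// ler_peMr.
have u0 : 0 <= 1 - t by rewrite subr_ge0.
rewrite (le_trans (ler_wpM2r _ h)) ?exprn_ge0// -exprMn exprn_ile1//; nra.
Qed.

Lemma step_poly_cvg0 y : 0 <= y < 2^-1 -> (step_poly n).[y] @[n --> \oo] --> (0 : R).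
Proof.
move=> /andP[y0 y1].
apply: (@squeeze_cvgr _ _ _ _ (fun=> 0) (fun n => (2 * y) ^+ n)); last 2 first.
- exact: cvg_cst.
- by apply: cvg_expr; rewrite ger0_norm; lra.
apply: nearW => n; have y01 : 0 <= y <= 1 by lra.
have /andP[-> _] := step_poly_bounded n y01; rewrite step_polyE.
have := @bernoulli_lower (y ^+ n) (2 ^ n); rewrite exprn_ge0 ?exprn_ile1//; last lra.
by move=> /(_ isT); rewrite exprMn natrX; lra.
Qed.

Lemma step_poly_cvg1 y : 2^-1 < y <= 1 -> (step_poly n).[y] @[n --> \oo] --> (1 : R).
Proof.
move=> /andP[y0 y1].
apply: (@squeeze_cvgr _ _ _ _ (fun n => 1 - (2 * y)^-1 ^+ n) (fun=> 1)); last 2 first.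
- rewrite -[X in _ --> X]subr0; apply: cvgB; first exact: cvg_cst.
  apply: cvg_expr; rewrite ger0_norm ?invr_ge0; last lra.
  by rewrite invf_lt1; lra.
- exact: cvg_cst.
apply: nearW => n; have y01 : 0 <= y <= 1 by lra.
have /andP[_ ->] := step_poly_bounded n y01; rewrite step_polyE andbT.
rewrite lerD2l lerN2.
have := @bernoulli_upper (y ^+ n) (2 ^ n); rewrite exprn_ge0 ?exprn_ile1//; [|lra..].
move=> /(_ isT); rewrite natrX -exprMn => h.
rewrite exprVn -div1r ler_pdivlMr; first by rewrite mulrC.
by rewrite exprn_gt0//; lra.
Qed.

End StepPolynomials.

(** * Completeness of trigonometric polynomials *)

Section Completeness.
Context {R : realType}.
Local Notation mu := (@lebesgue_measure R).
Local Notation GR := (measurableTypeR R).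
Implicit Types (f g : R -> R) (x y c d t : R).

Lemma cos_arc_lt d t : 0 < d <= pi -> `|t| < d -> cos d < cos t.
Proof.
move=> /andP[d0 dpi] td; rewrite -(cos_norm t) ltr_cos// in_itv/=.
- by rewrite normr_ge0/= ltW// (lt_le_trans td).
- by rewrite (ltW d0).
Qed.

Lemma cos_arc_gt d t : 0 < d <= pi -> d < `|t| < pi *+ 2 - d -> cos t < cos d.
Proof.
move=> /andP[d0 dpi] /andP[dt tpi]; rewrite -(cos_norm t).
(* Beyond [pi] the cosine increases again; reflection to [2 pi - |t|] returns to the interval where
   it decreases. *)
have [tp|pt] := leP `|t| pi.
  by rewrite ltr_cos// in_itv/= ?(ltW d0)// normr_ge0.
rewrite -(cosN `|t|) -cosD2pi ltr_cos// ?in_itv/= ?(ltW d0)//; last lra.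
by move: pt tpi; rewrite mulr2n; lra.
Qed.

Lemma ae_on_neq l c : ae_on l (fun x => x <> c).
Proof.
exists [set c]; split => //; first exact: lebesgue_measure_set1.
by move=> x /= h; apply: contrapT => xc; apply: h.
Qed.

Variables (l w : R).
Hypotheses (l0 : 0 < l) (wl : w * l = pi *+ 2).

Let w0 : 0 < w.
Proof. by rewrite -(pmulr_lgt0 _ l0) wl mulr2n addr_gt0// pi_gt0. Qed.

(* [step_poly n] of a trigonometric polynomial exceeding 1/2 exactly on the arc
   tends to the indicator function of that arc. *)
Lemma rint_short_arc f x1 x2 : L1 l f ->
  (forall g, trigpoly w g -> rint l (fun x => f x * g x) = 0) ->
  0 <= x1 -> x1 < x2 -> x2 <= l -> x2 - x1 < l / 2 -> rint x2 f = rint x1 f.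
Proof.
move=> hf hfg x10 x12 x2l xl.
pose c := (x1 + x2) / 2; pose d := w * (x2 - x1) / 2.
have d0 : 0 < d by rewrite /d divr_gt0// mulr_gt0// subr_gt0.
have dpi : d < pi / 2.
  have : w * (x2 - x1) < w * (l / 2) by rewrite ltr_pM2l.
  by rewrite mulrA wl /d mulr2n; lra.
have k0 : 0 < cos d by rewrite cos_gt0_pihalf//; have := pi_gt0 R; lra.
(* With this [r], [Y] equals 1/2 at angular distance [d] from the centre [c], that is at the ends of
   the arc. Its maximum [2 r] is at most 1 because [cos d] is positive, which is why the arc must be
   shorter than half a period. *)
pose r := (2 * (1 + cos d))^-1.
have r0 : 0 < r by rewrite invr_gt0; lra.
have rk : r + r * cos d = 2^-1 by rewrite /r; field; lra.
pose Y x := r + r * cos (w * (x - c)).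
have Y01 x : 0 <= Y x <= 1.
  have := cos_geN1 (w * (x - c)); have := cos_le1 (w * (x - c)); rewrite /Y.
  by nra.
pose h n x := (step_poly n).[Y x].
have th n : trigpoly w (h n) by exact: trig_horner.
pose f_ n x := (f x * h n x)%:E.
pose I : set GR := [set` `]x1, x2]].
have mh n : measurable_fun `[0, l] (h n).
  apply: measurable_funTS; apply: continuous_measurable_fun.
  exact: trig_continuous (th n).
have h1 n x : `|h n x| <= 1.
  by have /andP[? ?] := step_poly_bounded n (Y01 x); rewrite ger0_norm.
(* The excluded points are those where [Y] may equal 1/2: the two ends of the arc, and also 0 and
   [l], since periodicity identifies 0 with [x2] when [x2 = l], and [l] with [x1] when [x1 = 0]. *)
have hlim : ae_on l (fun x => h n x @[n --> \oo] --> (\1_I x : R)).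
  apply: (ae_on_imp _ (ae_on_and (ae_on_and (ae_on_neq l 0) (ae_on_neq l l))
    (ae_on_and (ae_on_neq l x1) (ae_on_neq l x2)))) => x /andP[xge xle].
  move=> [[/eqP x0' /eqP xl'] [/eqP xx1 /eqP xx2]].
  have x_0 : 0 < x by rewrite lt_neqAle eq_sym x0'.
  have x_l : x < l by rewrite lt_neqAle xl'.
  have dpi' : 0 < d <= pi by rewrite d0/=; have := pi_gt0 R; lra.
  have wdl : w * (l - (x2 - x1) / 2) = pi *+ 2 - d by rewrite mulrBr wl /d; ring.
  have wd : w * ((x2 - x1) / 2) = d by rewrite /d mulrA.
  have [xI|xI] := boolP (x \in I).
    have -> : \1_I x = 1 :> R by rewrite indicE xI.
    move: xI; rewrite mem_setE in_itv/= => /andP[x1x xx2'].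
    have x_2 : x < x2 by rewrite lt_neqAle xx2.
    apply: step_poly_cvg1; have /andP[_ ->] := Y01 x; rewrite andbT.
    have : cos d < cos (w * (x - c)).
      apply: cos_arc_lt => //; rewrite normrM gtr0_norm// -wd ltr_pM2l//.
      by rewrite /c ltr_norml; lra.
    rewrite -(ltr_pM2l r0 (cos _) (cos _)) /Y; lra.
  have -> : \1_I x = 0 :> R by rewrite indicE (negbTE xI).
  move: xI; rewrite mem_setE in_itv/= negb_and -leNgt -ltNge => xI.
  apply: step_poly_cvg0; have /andP[-> _] := Y01 x; rewrite /=.
  have : cos (w * (x - c)) < cos d.
    apply: cos_arc_gt => //; rewrite normrM (gtr0_norm w0) -wdl -{1}wd !ltr_pM2l//.
    have [xx1'|x2x] := orP xI.
      have {}xx1' : x < x1 by rewrite lt_neqAle xx1.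
      by rewrite ler0_norm /c; lra.
    by rewrite ger0_norm /c; lra.
  rewrite -(ltr_pM2l r0 (cos _) (cos _)) /Y; lra.
have mf := L1_measurable hf.
have mI : measurable_fun `[0, l] (fun x => f x * \1_I x).
  apply: measurable_funM => //; apply: measurable_funTS.
  by apply: measurable_indic; exact: measurable_itv.
have hfI : L1 l (fun x => f x * \1_I x).
  apply: (L1_le mI (L1_norm hf)) => x _; rewrite normrM -[leRHS]mulr1 ler_wpM2l//.
  by rewrite indicE; case: (_ \in _); rewrite ?normr1 ?normr0.
have [|||||_ _] := @dominated_convergence _ _ _ mu `[0, l]%classic (measurable_itv _) f_
   (fun x => (f x * \1_I x)%:E) (fun x => (`|f x|)%:E).
- by move=> n; apply/measurable_EFinP; apply: measurable_funM => //; exact: mh.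
- exact/measurable_EFinP.
- apply: (ae_on_imp _ hlim) => x _ hx.
  by apply: cvg_EFin; [exact: nearW|apply: cvgM hx; exact: cvg_cst].
- exact: L1_norm.
- apply: aeW => x n _; rewrite lee_fin normrM -[leRHS]mulr1 ler_wpM2l//.
rewrite [X in X @ _](_ : _ = fun=> 0%E); last first.
  apply/funext => n; rewrite -[0%E]/(0%R%:E) -[in RHS](hfg _ (th n)).
  by apply: rintE; apply: L1M_bounded hf (mh n) _ => x _; exact: h1.
move=> /cvg_lim; rewrite lim_cst// => /(_ (@ereal_hausdorff R)).
rewrite rintE// => -[] /esym.
rewrite (@eq_rint _ _ _ (f \_ I)); last first.
  by move=> x _; rewrite patchE indicE; case: ifP; rewrite ?mulr1 ?mulr0.
rewrite /rint -Rintegral_mkcondr (_ : _ `&` _ = I); last first.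
  apply/seteqP; split=> x /=; first by move=> [].
  by rewrite /I/= !in_itv/= => /andP[? ?]; split=> //; lra.
rewrite -!/(rint _ _) (rintS (L1S x2l hf) (_ : 0 <= x1 <= x2)) ?x10 ?ltW//.
by move=> ->; rewrite addr0.
Qed.

(** Every primitive [rint x f] vanishes by the result on arcs, so the Lebesgue differentiation
    theorem, applied to [f] extended by zero, gives [f = 0] almost everywhere. *)
Lemma trig_complete f : L1 l f ->
  (forall g, trigpoly w g -> rint l (fun x => f x * g x) = 0) ->
  ae_on l (fun x => f x = 0).
Proof.
move=> hf hfg.
have hr x : 0 <= x <= l -> rint x f = 0.
  move=> /andP[x0 xl]; have [->|xn0] := eqVneq x 0; first exact: rint0.
  have {xn0} x0 : 0 < x by rewrite lt_neqAle eq_sym xn0.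
  (* Three steps, because halves of [[0, x]] would have length exactly [l / 2] when [x = l], and the
     arcs must be strictly shorter. *)
  rewrite (@rint_short_arc f (2 / 3 * x))//; [|lra..].
  rewrite (@rint_short_arc f (1 / 3 * x))//; [|lra..].
  by rewrite (@rint_short_arc f 0)//; [exact: rint0|lra..].
pose F : R -> R := f \_ `[0, l].
have iF : mu.-integrable setT (EFin \o F) by exact: L1_integrableT.
have F0 x : \int[mu]_(t in `]-oo, x]) F t = 0.
  rewrite -Rintegral_mkcondr.
  have [x0|x0] := ltP x 0.
    rewrite (_ : _ `&` _ = set0) ?Rintegral_set0//.
    by apply/seteqP; split=> y //= [/=]; rewrite !in_itv/=; lra.
  rewrite (_ : _ `&` _ = [set` `[0, Num.min x l]]).
    by apply: hr; rewrite le_min x0 (ltW l0) ge_min lexx orbT.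
  apply/seteqP; split=> y /=; rewrite !in_itv/= le_min.
    by move=> [-> /andP[-> ->]].
  by move=> /and3P[-> -> ->].
have iFy y : mu.-integrable `]-oo, y] (EFin \o F) by exact: integrableS iF.
have lF : locally_integrable setT F by exact: integrable_locally hf.
have := FTC1Ny iFy lF.
rewrite (_ : (fun x => \int[mu]_(t in `]-oo, x]) F t) = fun=> 0) => [h|]; last exact/funext.
have : ae_on l (fun x => derivable ((fun=> 0) : R -> R) x 1 /\
    derive1 ((fun=> 0) : R -> R) x = F x).
  by apply: filterS h; [exact: (ae_filter_ringOfSetsType mu)|move=> x hx _].
apply: ae_on_imp => x xl [_]; rewrite derive1_cst => /esym.
by rewrite /F patchE mem_segment xl.
Qed.
End Completeness.

(** * Real weak derivatives *)

Section WeakDerivative.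
Context {R : realType}.
Local Notation mu := (@lebesgue_measure R).
Variable l : R.
Hypothesis l0 : 0 < l.
Implicit Types (f g p q P Q phi : R -> R) (x y : R).

Let l_ge0 : 0 <= l. Proof. exact: ltW. Qed.

Definition L2_periodic p := [/\ forall x, p (x + l) = p x, measurable_fun setT p &
  L1 l (fun x => p x ^+ 2)].

Definition weak_deriv p p1 := [/\ L2_periodic p, L2_periodic p1 & forall phi, test_function l phi ->
  rint l (fun x => p x * derive1 phi x) = - rint l (fun x => p1 x * phi x)].

Lemma L1_ae f g : measurable_fun `[0, l] g -> ae_on l (fun x => f x = g x) ->
  L1 l f -> L1 l g.
Proof.
move=> mg fg hf; apply/integrableP; split; first exact/measurable_EFinP.
have mf := L1_measurable hf.
have /integrableP[_] := hf; congr (_ < _)%E.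
apply: ae_eq_integral => //=.
- by apply/measurable_EFinP; apply: measurableT_comp.
- by apply/measurable_EFinP; apply: measurableT_comp.
- by apply: (ae_on_imp _ fg) => x _ /= ->.
Qed.

Lemma L2_periodic_measurable p : L2_periodic p -> measurable_fun `[0, l] p.
Proof. by move=> [_ h _]; exact: measurable_funTS. Qed.

Lemma L2_periodic_L1M p q : L2_periodic p -> L2_periodic q -> L1 l (fun x => p x * q x).
Proof.
move=> hp hq; have mp := L2_periodic_measurable hp; have mq := L2_periodic_measurable hq.
have [[_ _ ip] [_ _ iq]] := (hp, hq).
apply: (L1_le _ (L1D ip iq)) => [|x _]; first exact: measurable_funM.
by rewrite ler_norml; have := sqr_ge0 (p x - q x); have := sqr_ge0 (p x + q x); nra.
Qed.

Lemma L2_periodic_cst c : L2_periodic (fun=> c).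
Proof. by split=> //; exact: L1_cst. Qed.

Lemma L2_periodic_L1 p : L2_periodic p -> L1 l p.
Proof.
move=> hp; have := L2_periodic_L1M hp (L2_periodic_cst 1).
by under eq_fun do rewrite mulr1.
Qed.

Lemma L2_periodic_add p q : L2_periodic p -> L2_periodic q -> L2_periodic (fun x => p x + q x).
Proof.
move=> hp hq; have [[pp mp ip] [pq mq iq]] := (hp, hq); split.
- by move=> x; rewrite pp pq.
- exact: measurable_funD.
- have := L1D (L1D ip iq) (L1Z 2 (L2_periodic_L1M hp hq)).
  by congr L1; apply/funext => x; ring.
Qed.

Lemma L2_periodic_scale c p : L2_periodic p -> L2_periodic (fun x => c * p x).
Proof.
move=> [pp mp ip]; split.
- by move=> x; rewrite pp.
- exact: measurable_funM.
- by have := L1Z (c ^+ 2) ip; congr L1; apply/funext => x; ring.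
Qed.

Lemma test_deriv phi : test_function l phi -> has_deriv phi (derive1 phi).
Proof.
by move=> [_ /(_ 0)] h x; apply: DeriveDef; [exact: h|rewrite derive1E].
Qed.

Lemma test_abs_cont phi : test_function l phi -> abs_cont l phi (derive1 phi).
Proof.
move=> [_ h]; apply: abs_cont_C1 => [x|x]; first exact: (h 0).
by apply: differentiable_continuous; apply/derivable1_diffP; exact: (h 1).
Qed.

Lemma test_derive1 phi : test_function l phi -> test_function l (derive1 phi).
Proof.
move=> h; have [pphi dphi] := h; split; last first.
  by move=> n x; rewrite -derive1n1 /derive1n -iterD addn1; exact: (dphi n.+1).
have hd : has_deriv (fun x => phi (x + l)) (fun x => derive1 phi (x + l)).
  have hl : has_deriv (fun x : R => x + l) (fun=> 1).
    have := has_deriv_add (has_deriv_linear 1) (has_deriv_cst l).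
    by congr has_deriv; apply/funext => x; rewrite ?mul1r ?addr0.
  have := has_deriv_comp (test_deriv h) hl.
  by congr has_deriv; apply/funext => x; rewrite mulr1.
move=> x; rewrite -[LHS]/((fun x => derive1 phi (x + l)) x).
by rewrite -(has_deriv_derive1 hd); congr (derive1 _ x); apply/funext => y.
Qed.

Lemma test_L1M f phi : L1 l f -> test_function l phi -> L1 l (fun x => f x * phi x).
Proof. by move=> hf /test_abs_cont h; exact: abs_cont_L1M h hf. Qed.

Lemma test_L2_periodic phi : test_function l phi -> L2_periodic phi.
Proof.
move=> h; have aphi := test_abs_cont h; have [pphi _] := h; split=> //.
  by apply: continuous_measurable_fun; exact: has_deriv_continuous (test_deriv h).
exact: abs_cont_L1 (abs_cont_mul l_ge0 aphi aphi).
Qed.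

(** Converse of the du Bois-Reymond lemma: integrating the density of [P * phi] over one period, the
    boundary terms cancel because both factors take equal values at 0 and [l]. *)
Lemma abs_cont_weak_deriv P p p1 : L2_periodic p -> L2_periodic p1 ->
  abs_cont l P p1 -> P l = P 0 ->
  ae_on l (fun x => p x = P x) -> weak_deriv p p1.
Proof.
move=> hp hp1 aP Pl pP; split=> // phi tphi.
have aphi := test_abs_cont tphi; have [hphi _] := aphi.
have [_ /(_ l)] := abs_cont_mul l_ge0 aP aphi; rewrite l_ge0 lexx => /(_ isT).
have -> : phi l = phi 0 by have [+ _] := tphi => /(_ 0); rewrite add0r.
rewrite Pl rintD; last 2 first.
- by apply: test_L1M tphi; exact: L2_periodic_L1.
- by under eq_fun do rewrite mulrC; exact: abs_cont_L1M aP hphi.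
rewrite (@rint_ae _ _ (fun x => p x * derive1 phi x) (fun x => P x * derive1 phi x)).
- lra.
- by apply: measurable_funM; [exact: L2_periodic_measurable|exact: L1_measurable].
- by apply: measurable_funM; [exact: abs_cont_measurable aP|exact: L1_measurable].
- by apply: (ae_on_imp _ pP) => x _ ->.
Qed.

Let w := pi *+ 2 / l.
Let wl : w * l = pi *+ 2. Proof. by rewrite /w mulfVK// gt_eqF. Qed.
Let w0 : w != 0.
Proof. by rewrite mulf_neq0 ?invr_eq0 ?gt_eqF// mulr2n addr_gt0// pi_gt0. Qed.

Lemma test_cst c : test_function l (fun=> c).
Proof. exact (trig_test wl (trig_cst w c)). Qed.

(* du Bois-Reymond: subtracting the primitive of the weak derivative leaves a
   function orthogonal to every derivative of a trigonometric polynomial. *)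
Lemma weak_deriv_abs_cont p p1 : weak_deriv p p1 ->
  exists P, [/\ abs_cont l P p1, P l = P 0 & ae_on l (fun x => p x = P x)].
Proof.
move=> [hp hp1 hpp1]; have [ip ip1] := (L2_periodic_L1 hp, L2_periodic_L1 hp1).
pose V x := rint x p1.
(* Testing against the constant 1 gives mean zero, so the primitive [V] closes up over a period. *)
have ip10 : rint l p1 = 0.
  have := hpp1 _ (test_cst 1); rewrite (has_deriv_derive1 (has_deriv_cst 1)).
  under eq_rint do rewrite mulr0.
  under [X in _ = - X]eq_rint do rewrite mulr1.
  by rewrite rint_cst// mul0r => /eqP; rewrite eq_sym oppr_eq0 => /eqP.
have aV : abs_cont l V p1 by split=> // x _; rewrite /V rint0 add0r.
have iV := abs_cont_L1 l_ge0 aV.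
(* Chosen so that [p - P] has mean zero, which removes the constant [c] produced by
   [trig_antideriv]. *)
pose m := (rint l p - rint l V) / l.
pose P x := V x + m.
have aP : abs_cont l P p1 by split=> // x _; rewrite /P/V rint0 add0r addrC.
have iP := abs_cont_L1 l_ge0 aP.
exists P; split=> //; first by rewrite /P /V ip10 rint0.
have if_ : L1 l (fun x => p x - P x) by exact: L1B.
have if0 : rint l (fun x => p x - P x) = 0.
  rewrite rintB// rintD//; last exact: L1_cst.
  by rewrite rint_cst// /m; field; rewrite gt_eqF.
suff : ae_on l (fun x => p x - P x = 0).
  by apply: ae_on_imp => x _ /eqP; rewrite subr_eq0 => /eqP.
apply: (trig_complete l0 wl) => // g /(trig_antideriv w0)[c [G [G' [tG dG hG]]]].
have tG' := trig_test wl tG; have eG := has_deriv_derive1 dG.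
have aG := test_abs_cont tG'; have [iG' _] := aG.
have tG'' := test_derive1 tG'; rewrite eG in iG' tG''.
have GlG0 : G l = G 0 by have [+ _] := tG' => /(_ 0); rewrite add0r.
rewrite (@eq_rint _ _ _ (fun x => c * (p x - P x) + (p x * G' x - P x * G' x))); last first.
  by move=> x _; rewrite hG; ring.
have ipG := test_L1M ip tG''; have iPG := test_L1M iP tG''.
rewrite rintD; [|exact: L1Z|exact: L1B].
rewrite rintZ// if0 mulr0 add0r rintB//.
have := hpp1 _ tG'; rewrite eG => ->.
have [_ /(_ l)] := abs_cont_mul l_ge0 aP aG; rewrite eG l_ge0 lexx => /(_ isT).
rewrite GlG0 rintD; [|by apply: test_L1M tG'; exact: ip1|exact: iPG].
rewrite (_ : P l = P 0); last by rewrite /P /V ip10 rint0.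
lra.
Qed.

Lemma weak_deriv_unique p p1 p2 : weak_deriv p p1 -> weak_deriv p p2 ->
  ae_on l (fun x => p1 x = p2 x).
Proof.
move=> [hp hp1 h1] [_ hp2 h2]; have [ip1 ip2] := (L2_periodic_L1 hp1, L2_periodic_L1 hp2).
suff : ae_on l (fun x => p1 x - p2 x = 0).
  by apply: ae_on_imp => x _ /eqP; rewrite subr_eq0 => /eqP.
apply: (trig_complete l0 wl) => [|g tg]; first exact: L1B.
have tg' := trig_test wl tg.
rewrite (@eq_rint _ _ _ (fun x => p1 x * g x - p2 x * g x)); last first.
  by move=> x _; rewrite mulrBl.
rewrite rintB; [|exact: test_L1M..].
by have := h1 _ tg'; rewrite h2// => /oppr_inj ->; rewrite subrr.
Qed.

Lemma weak_deriv_ae p p1 q q1 : weak_deriv p p1 -> L2_periodic q -> L2_periodic q1 ->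
  ae_on l (fun x => p x = q x) -> ae_on l (fun x => p1 x = q1 x) -> weak_deriv q q1.
Proof.
move=> [hp hp1 h] hq hq1 pq pq1; split=> // phi tphi.
have mphi := L2_periodic_measurable (test_L2_periodic tphi).
have mphi' := L2_periodic_measurable (test_L2_periodic (test_derive1 tphi)).
rewrite (@rint_ae _ _ (fun x => q x * _) (fun x => p x * derive1 phi x)).
- rewrite h//; congr (- _); apply: rint_ae.
  + by apply: measurable_funM => //; exact: L2_periodic_measurable.
  + by apply: measurable_funM => //; exact: L2_periodic_measurable.
  + by apply: (ae_on_imp _ pq1) => x _ ->.
- by apply: measurable_funM => //; exact: L2_periodic_measurable.
- by apply: measurable_funM => //; exact: L2_periodic_measurable.
- by apply: (ae_on_imp _ pq) => x _ ->.
Qed.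

Lemma weak_deriv_add p p1 q q1 : weak_deriv p p1 -> weak_deriv q q1 ->
  weak_deriv (fun x => p x + q x) (fun x => p1 x + q1 x).
Proof.
move=> [hp hp1 h] [hq hq1 h']; split; [exact: L2_periodic_add..|] => phi tphi.
have tphi' := test_derive1 tphi.
have ip := test_L1M (L2_periodic_L1 hp) tphi'; have iq := test_L1M (L2_periodic_L1 hq) tphi'.
have ip1 := test_L1M (L2_periodic_L1 hp1) tphi; have iq1 := test_L1M (L2_periodic_L1 hq1) tphi.
under eq_rint do rewrite mulrDl.
under [in RHS]eq_rint do rewrite mulrDl.
by rewrite !rintD// h// h'// opprD.
Qed.

Lemma weak_deriv_scale c p p1 : weak_deriv p p1 ->
  weak_deriv (fun x => c * p x) (fun x => c * p1 x).
Proof.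
move=> [hp hp1 h]; split; [exact: L2_periodic_scale..|] => phi tphi.
have ip := test_L1M (L2_periodic_L1 hp) (test_derive1 tphi).
have ip1 := test_L1M (L2_periodic_L1 hp1) tphi.
under eq_rint do rewrite -mulrA.
under [in RHS]eq_rint do rewrite -mulrA.
by rewrite !rintZ// h// mulrN.
Qed.

Lemma weak_deriv_test phi : test_function l phi -> weak_deriv phi (derive1 phi).
Proof.
move=> h; apply: abs_cont_weak_deriv (test_abs_cont h) _ _.
- exact: test_L2_periodic.
- exact: test_L2_periodic (test_derive1 h).
- by have [+ _] := h => /(_ 0); rewrite add0r.
- exact: ae_onW.
Qed.

Lemma abs_cont_ae P p q : abs_cont l P p -> L1 l q ->
  ae_on l (fun x => p x = q x) -> abs_cont l P q.
Proof.
move=> [hp hP] hq pq; split=> // x /[dup] /andP[x0 xl] /hP ->; congr (_ + _).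
apply: rint_ae; [exact: L1_measurable (L1S xl hp)|exact: L1_measurable (L1S xl hq)|].
move: pq; rewrite /ae_on; apply: filterS; first exact: (ae_filter_ringOfSetsType mu).
by move=> y h /andP[y0 yx]; apply: h; rewrite y0 (le_trans yx).
Qed.

(** The absolutely continuous representatives satisfy the Leibniz rule exactly, and they are bounded
    on [[0, l]], which makes [p1 * q + p * q1] square integrable. *)
Lemma weak_deriv_mul p p1 q q1 : weak_deriv p p1 -> weak_deriv q q1 ->
  weak_deriv (fun x => p x * q x) (fun x => p1 x * q x + p x * q1 x).
Proof.
move=> hp hq; have [P [aP Pl pP]] := weak_deriv_abs_cont hp.
have [Q [aQ Ql qQ]] := weak_deriv_abs_cont hq.
have [lp lp1 _] := hp; have [lq lq1 _] := hq.
have [[pp mp _] [pp1 mp1 ip1]] := (lp, lp1).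
have [[pq mq _] [pq1 mq1 iq1]] := (lq, lq1).
have aPQ := abs_cont_mul l_ge0 aP aQ; have [iPQ _] := aPQ.
have hpq : ae_on l (fun x => P x * Q x = p x * q x).
  by apply: (ae_on_imp _ (ae_on_and pP qQ)) => x _ [-> ->].
have hpq1 : ae_on l (fun x => p1 x * Q x + P x * q1 x = p1 x * q x + p x * q1 x).
  by apply: (ae_on_imp _ (ae_on_and pP qQ)) => x _ [-> ->].
have L : L2_periodic (fun x => p x * q x).
  split; [by move=> x; rewrite pp pq|exact: measurable_funM|].
  apply: (L1_ae _ _ (abs_cont_L1 l_ge0 (abs_cont_mul l_ge0 aPQ aPQ))).
    by apply: measurable_funTS; apply: measurable_funX; exact: measurable_funM.
  by apply: (ae_on_imp _ hpq) => x _ ->.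
have L' : L2_periodic (fun x => p1 x * q x + p x * q1 x).
  split; [by move=> x; rewrite pp pq pp1 pq1|by apply: measurable_funD; exact: measurable_funM|].
  apply: (@L1_ae (fun x => p1 x ^+ 2 * (Q x * Q x)
     + 2 * (p1 x * q1 x * (P x * Q x)) + q1 x ^+ 2 * (P x * P x))).
  - apply: measurable_funTS; apply: measurable_funX.
    by apply: measurable_funD; exact: measurable_funM.
  - by apply: (ae_on_imp _ (ae_on_and pP qQ)) => x _ [-> ->]; ring.
  - have i1 := abs_cont_L1M l_ge0 (abs_cont_mul l_ge0 aQ aQ) ip1.
    have i2 := abs_cont_L1M l_ge0 aPQ (L2_periodic_L1M lp1 lq1).
    have i3 := abs_cont_L1M l_ge0 (abs_cont_mul l_ge0 aP aP) iq1.
    by apply: L1D i3; apply: L1D i1 _; exact: L1Z.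
apply: (@abs_cont_weak_deriv (fun x => P x * Q x)) => //; last first.
- by apply: (ae_on_imp _ hpq) => x _ ->.
- by rewrite Pl Ql.
- by apply: abs_cont_ae aPQ (L2_periodic_L1 L') _.
Qed.

(** The density of [P^2] is [2 P p1], bounded by [P^2 + p1^2], so two values of [P^2] differ by at
    most [2 H], with [H] the integral on the right. Averaging [P x ^ 2 <= P y ^ 2 + 2 H] over [y]
    gives the constant [l^-1 + 2]. *)
Lemma weak_deriv_sup p p1 : weak_deriv p p1 ->
  ae_on l (fun x => p x ^+ 2 <= (l^-1 + 2) * rint l (fun y => p y ^+ 2 + p1 y ^+ 2)).
Proof.
move=> hp; have [P [aP Pl pP]] := weak_deriv_abs_cont hp; have [lp lp1 _] := hp.
have [[_ mp ip] [_ mp1 ip1]] := (lp, lp1).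
have aP2 := abs_cont_mul l_ge0 aP aP; have iP2 := abs_cont_L1 l_ge0 aP2.
have [ih hP2] := aP2.
have iH : L1 l (fun y => P y ^+ 2 + p1 y ^+ 2) by exact: L1D.
pose H := rint l (fun y => P y ^+ 2 + p1 y ^+ 2).
have -> : rint l (fun y => p y ^+ 2 + p1 y ^+ 2) = H.
  apply: rint_ae.
  - by apply: measurable_funTS; apply: measurable_funD; exact: measurable_funX.
  - exact: L1_measurable.
  - by apply: (ae_on_imp _ pP) => x _ ->.
have hK : rint l (fun y => `|p1 y * P y + P y * p1 y|) <= H.
  apply: le_rint => //; first exact: L1_norm.
  move=> x _; rewrite ler_norml.
  by have := sqr_ge0 (P x - p1 x); have := sqr_ge0 (P x + p1 x); nra.
have hr x : 0 <= x <= l -> `|P x * P x - P 0 * P 0| <= H.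
  move=> xl; rewrite hP2// addrC addKr.
  by rewrite (le_trans (le_rint_itv ih xl)).
apply: (ae_on_imp _ pP) => x xl ->.
have : rint l (fun=> P x ^+ 2) <= rint l (fun y => P y * P y + 2 * H).
  apply: le_rint; [exact: L1_cst|by apply: L1D => //; exact: L1_cst|].
  move=> y yl; have := hr _ xl; have := hr _ yl.
  by rewrite !ler_norml => /andP[h1 h2] /andP[h3 h4]; rewrite expr2; lra.
rewrite rintD//; last exact: L1_cst.
rewrite !rint_cst// => h.
have : rint l (fun y => P y * P y) <= H.
  by apply: le_rint => // y _; rewrite expr2 lerDl sqr_ge0.
move=> h'; rewrite -(ler_pM2r l0) (le_trans h)//.
rewrite [leRHS](_ : _ = H + 2 * H * l); last by field; rewrite gt_eqF.
by rewrite lerD2r.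
Qed.

End WeakDerivative.

(** * Complex weak derivatives and the functional *)

Section ComplexWeakDerivative.
Context {R : realType}.
Variable l : R.
Hypothesis l0 : 0 < l.
Implicit Types (u v w : R -> R[i]) (f g p q phi : R -> R) (x : R).
Local Notation RE u := (fun x => complex.Re (u x)).
Local Notation IM u := (fun x => complex.Im (u x)).

Lemma complex_eqP (z z' : R[i]) :
  z = z' <-> complex.Re z = complex.Re z' /\ complex.Im z = complex.Im z'.
Proof. by split=> [-> //|]; case: z => a b; case: z' => c d /= [-> ->]. Qed.

Lemma L2perP u : L2per l u <-> L2_periodic l (RE u) /\ L2_periodic l (IM u).
Proof.
split=> [[pu mr mi iu]|[[pr mr ir] [pi mi ii]]].
  have m2 f : measurable_fun setT f -> measurable_fun `[0, l] (fun x => f x ^+ 2).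
    by move=> mf; apply: measurable_funTS; exact: measurable_funX.
  split; split=> //; try by move=> x; rewrite pu.
    apply: (L1_le (m2 _ mr) iu) => x _.
    by rewrite ger0_norm ?sqr_ge0// /abs2 lerDl sqr_ge0.
  apply: (L1_le (m2 _ mi) iu) => x _.
  by rewrite ger0_norm ?sqr_ge0// /abs2 lerDr sqr_ge0.
by split=> //; [move=> x; apply/complex_eqP; rewrite pr pi|exact: L1D].
Qed.

Lemma ReMr (z : R[i]) (c : R) : complex.Re (z * c%:C) = complex.Re z * c.
Proof. by case: z => a b /=; rewrite mulr0 subr0. Qed.

Lemma ImMr (z : R[i]) (c : R) : complex.Im (z * c%:C) = complex.Im z * c.
Proof. by case: z => a b /=; rewrite mulr0 add0r. Qed.

Lemma weak_derivativeP u v : is_weak_derivative l u v <->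
  weak_deriv l (RE u) (RE v) /\ weak_deriv l (IM u) (IM v).
Proof.
have cintE phi psi : cint l (fun x => u x * (phi x)%:C) = - cint l (fun x => v x * (psi x)%:C)
    <-> rint l (fun x => complex.Re (u x) * phi x) = - rint l (fun x => complex.Re (v x) * psi x)
    /\ rint l (fun x => complex.Im (u x) * phi x) = - rint l (fun x => complex.Im (v x) * psi x).
  rewrite complex_eqP /cint /=.
  under eq_rint do rewrite ReMr.
  under [rint l (fun x => complex.Im (u x * _))]eq_rint do rewrite ImMr.
  under [rint l (fun x => complex.Re (v x * _))]eq_rint do rewrite ReMr.
  by under [rint l (fun x => complex.Im (v x * _))]eq_rint do rewrite ImMr.
split=> [[/L2perP[hr hi] /L2perP[hr1 hi1] h]|[[hr hr1 h1] [hi hi1 h2]]].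
  by split; split=> // phi /h /cintE[].
split; [exact/L2perP|exact/L2perP|] => phi tphi.
by apply/cintE; split; [exact: h1|exact: h2].
Qed.

Lemma wderive_weak u v : is_weak_derivative l u v -> is_weak_derivative l u (wderive l u).
Proof. by move=> h; apply: (xgetPex _ (ex_intro _ v h)). Qed.

Lemma wderive_weak_deriv u p1 q1 : weak_deriv l (RE u) p1 -> weak_deriv l (IM u) q1 ->
  [/\ weak_deriv l (RE u) (RE (wderive l u)), weak_deriv l (IM u) (IM (wderive l u)),
    ae_on l (fun x => complex.Re (wderive l u x) = p1 x) &
    ae_on l (fun x => complex.Im (wderive l u x) = q1 x)].
Proof.
move=> hp hq; have : is_weak_derivative l u (fun x => p1 x +i* q1 x).
  by apply/weak_derivativeP.
move=> /wderive_weak/weak_derivativeP[h1 h2]; split=> //.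
- exact: (weak_deriv_unique l0 h1 hp).
- exact: (weak_deriv_unique l0 h2 hq).
Qed.

Lemma wderive2_weak_deriv u p1 q1 p2 q2 : weak_deriv l (RE u) p1 -> weak_deriv l (IM u) q1 ->
  weak_deriv l p1 p2 -> weak_deriv l q1 q2 ->
  [/\ weak_deriv l (RE (wderive l u)) (RE (wderive l (wderive l u))),
    weak_deriv l (IM (wderive l u)) (IM (wderive l (wderive l u))),
    ae_on l (fun x => complex.Re (wderive l (wderive l u) x) = p2 x) &
    ae_on l (fun x => complex.Im (wderive l (wderive l u) x) = q2 x)].
Proof.
move=> hp hq hp1 hq1; have [h1 h2 e1 e2] := wderive_weak_deriv hp hq.
have [[_ l1 _] [_ l2 _]] := (h1, h2).
have [[l3 l4 _] [l5 l6 _]] := (hp1, hq1).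
apply: wderive_weak_deriv.
- by apply: (weak_deriv_ae l0 hp1) => //; [apply: (ae_on_imp _ e1) => x _ ->|exact: ae_onW].
- by apply: (weak_deriv_ae l0 hq1) => //; [apply: (ae_on_imp _ e2) => x _ ->|exact: ae_onW].
Qed.

(** Carries chosen representatives of the derivatives: smooth ones for the breather, those picked by
    [wderive] for a general increment, and sums of the two. *)
Definition H2jet u p1 q1 p2 q2 :=
  [/\ weak_deriv l (RE u) p1, weak_deriv l (IM u) q1, weak_deriv l p1 p2 & weak_deriv l q1 q2].

Lemma H2perP u : H2per l u -> H2jet u (RE (wderive l u)) (IM (wderive l u))
  (RE (wderive l (wderive l u))) (IM (wderive l (wderive l u))).
Proof.
move=> [v [v' [/weak_derivativeP[h1 h2] /weak_derivativeP[h3 h4]]]].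
have [k1 k2 _ _] := wderive_weak_deriv h1 h2.
by have [k3 k4 _ _] := wderive2_weak_deriv h1 h2 h3 h4.
Qed.

Lemma H2jet_H2per u p1 q1 p2 q2 : H2jet u p1 q1 p2 q2 -> H2per l u.
Proof.
move=> [h1 h2 h3 h4]; exists (fun x => p1 x +i* q1 x), (fun x => p2 x +i* q2 x).
by split; apply/weak_derivativeP.
Qed.

Lemma weak_deriv_bounded p p1 : weak_deriv l p p1 -> exists M, ae_on l (fun x => `|p x| <= M).
Proof.
move=> /(weak_deriv_sup l0) h; set B := (_ + _) * _ in h; exists (1 + B).
apply: (ae_on_imp _ h) => x _ hx.
rewrite ler_norml; have := sqr_ge0 (p x - 1); have := sqr_ge0 (p x + 1); nra.
Qed.

Lemma L1_le_ae f g : measurable_fun `[0, l] f -> L1 l g ->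
  ae_on l (fun x => `|f x| <= g x) -> L1 l f.
Proof.
move=> mf hg h; have mg := L1_measurable hg.
(* Clamping [f] to [[- |g|, |g|]] changes it on a null set only and makes the domination hold at
   every point. *)
apply: (@L1_ae _ _ (fun x => Num.max (- `|g x|) (Num.min `|g x| (f x)))) => //.
  apply: (ae_on_imp _ h) => x _ hx.
  have := le_trans hx (ler_norm _); rewrite ler_norml => /andP[h1 h2].
  by rewrite min_r// max_r.
have mng : measurable_fun `[0, l] (fun x => `|g x|) by exact: measurableT_comp.
apply: (L1_le _ (L1_norm hg)) => [|x _].
  apply: measurable_maxr; first exact: measurable_funN.
  exact: measurable_minr.
rewrite ler_norml ge_max ge_min lexx /= le_max lexx /= andbT.
by have := normr_ge0 (g x); lra.
Qed.

Lemma L1M_ae_bounded f g M : L1 l f -> measurable_fun `[0, l] g ->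
  ae_on l (fun x => `|g x| <= M) -> L1 l (fun x => f x * g x).
Proof.
move=> hf mg h; apply: (@L1_le_ae _ (fun x => M * `|f x|)).
- by apply: measurable_funM => //; exact: L1_measurable.
- by apply: L1Z; exact: L1_norm.
- by apply: (ae_on_imp _ h) => x _ hx; rewrite normrM mulrC ler_wpM2r.
Qed.

Lemma L1M_weak_deriv f p p1 : L1 l f -> weak_deriv l p p1 -> L1 l (fun x => f x * p x).
Proof.
move=> hf hp; have [M hM] := weak_deriv_bounded hp; have [lp _ _] := hp.
exact: L1M_ae_bounded hf (L2_periodic_measurable lp) hM.
Qed.

(* Integrand of F - k E at a function with real and imaginary parts p, q. *)
Definition lagrangian (k p q p1 q1 p2 q2 : R) : R :=
  (p2 ^+ 2 + q2 ^+ 2) - 3 * (p ^+ 2 + q ^+ 2 - 1) * (p1 ^+ 2 + q1 ^+ 2)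
  - 2^-1 * (2 * (p * p1 + q * q1)) ^+ 2 + 2^-1 * (p ^+ 2 + q ^+ 2 - 1) ^+ 3
  - k * ((p1 ^+ 2 + q1 ^+ 2) - 2^-1 * (p ^+ 2 + q ^+ 2 - 1) ^+ 2).

Lemma measurable_sqrD p q : L2_periodic l p -> L2_periodic l q ->
  measurable_fun `[0, l] (fun x => p x ^+ 2 + q x ^+ 2).
Proof.
by move=> hp hq; apply: measurable_funD; apply: measurable_funX; exact: L2_periodic_measurable.
Qed.

(** Frees the energies from the choices made by [wderive], including the one in the derivative of
    [|u|^2], which the Leibniz rule identifies with [2 (p p1 + q q1)]. *)
Lemma energies_rint u p1 q1 p2 q2 k : H2jet u p1 q1 p2 q2 ->
  L1 l (fun x => lagrangian k (complex.Re (u x)) (complex.Im (u x)) (p1 x) (q1 x) (p2 x) (q2 x)) /\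
  energyF l u - k * energyE l u =
  rint l (fun x => lagrangian k (complex.Re (u x)) (complex.Im (u x)) (p1 x) (q1 x) (p2 x) (q2 x)).
Proof.
move=> [hp hq hp1 hq1].
set p := RE u in hp *; set q := IM u in hq *.
have [lp lp1 _] := hp; have [lq lq1 _] := hq; have [_ lp2 _] := hp1; have [_ lq2 _] := hq1.
pose m x := p x ^+ 2 + q x ^+ 2 - 1.
pose dm x := 2 * (p x * p1 x + q x * q1 x).
(* Weak differentiability of [m = |u|^2 - 1] makes it bounded almost everywhere; hence [m |u_x|^2]
   and [m^3] are integrable. *)
have hm : weak_deriv l m dm.
  have := weak_deriv_add l0 (weak_deriv_add l0 (weak_deriv_mul l0 hp hp) (weak_deriv_mul l0 hq hq))
    (weak_deriv_test l0 (test_cst l0 (-1))).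
  by congr weak_deriv; apply/funext => x;
    rewrite ?(has_deriv_derive1 (has_deriv_cst _)) /m /dm; ring.
have [lm ldm _] := hm.
have iS2 := L1D (L2_periodic_L1M lp2 lp2) (L2_periodic_L1M lq2 lq2).
have iS1 := L1D (L2_periodic_L1M lp1 lp1) (L2_periodic_L1M lq1 lq1).
have iS1m := L1M_weak_deriv iS1 hm.
have idm2 := L2_periodic_L1M ldm ldm.
have im2 := L2_periodic_L1M lm lm.
have im3 := L1M_weak_deriv im2 hm.
pose e x := (p1 x ^+ 2 + q1 x ^+ 2) - 2^-1 * m x ^+ 2.
pose f x := (p2 x ^+ 2 + q2 x ^+ 2) - 3 * m x * (p1 x ^+ 2 + q1 x ^+ 2)
  - 2^-1 * dm x ^+ 2 + 2^-1 * m x ^+ 3.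
have ie : L1 l e.
  have := L1B iS1 (L1Z 2^-1 im2); congr L1; apply/funext => x; rewrite /e; ring.
have if_ : L1 l f.
  have := L1D (L1B (L1B iS2 (L1Z 3 iS1m)) (L1Z 2^-1 idm2)) (L1Z 2^-1 im3).
  by congr L1; apply/funext => x; rewrite /f; ring.
have densE : (fun x => lagrangian k (p x) (q x) (p1 x) (q1 x) (p2 x) (q2 x)) =
    fun x => f x - k * e x.
  by apply/funext => x.
rewrite densE; split; first by apply: L1B => //; exact: L1Z.
rewrite rintB ?rintZ//; last exact: L1Z.
have [h1 h2 e1 e2] := wderive_weak_deriv hp hq.
have [h3 h4 e3 e4] := wderive2_weak_deriv hp hq hp1 hq1.
have [h5 _ e5 _] : [/\ weak_deriv l (RE (fun x => (abs2 (u x))%:C))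
    (RE (wderive l (fun x => (abs2 (u x))%:C))),
  True, ae_on l (fun x => complex.Re (wderive l (fun x => (abs2 (u x))%:C) x) = dm x) & True].
  have ha : weak_deriv l (RE (fun x => (abs2 (u x))%:C)) dm.
    have := weak_deriv_add l0 (weak_deriv_mul l0 hp hp) (weak_deriv_mul l0 hq hq).
    by congr weak_deriv; apply/funext => x; rewrite /dm /abs2/= /p /q; ring.
  have h0 : weak_deriv l (IM (fun x => (abs2 (u x))%:C)) (fun=> 0).
    by have := weak_deriv_test l0 (test_cst l0 0); rewrite (has_deriv_derive1 (has_deriv_cst _)).
  by have [] := wderive_weak_deriv ha h0.
have [[_ l1 _] [_ l2 _] [_ l3 _] [_ l4 _] [_ l5 _]] := And5 h1 h2 h3 h4 h5.
have m12 := measurable_sqrD l1 l2; have m34 := measurable_sqrD l3 l4.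
have mm := L2_periodic_measurable lm.
congr (_ - k * _); apply: rint_ae.
- apply: measurable_funD; last first.
    by apply: measurable_funM => //; apply: measurable_funX.
  apply: measurable_funD; last first.
    apply: measurable_funN; apply: measurable_funM => //; apply: measurable_funX.
    exact: L2_periodic_measurable.
  apply: measurable_funD => //; apply: measurable_funN.
  by apply: measurable_funM => //; apply: measurable_funM.
- exact: L1_measurable.
- apply: (ae_on_imp _ (ae_on_and (ae_on_and (ae_on_and e1 e2) (ae_on_and e3 e4)) e5)) => x _.
  by rewrite /abs2 => -[[[-> ->] [-> ->]] ->].
- apply: measurable_funD => //; apply: measurable_funN.
  by apply: measurable_funM => //; apply: measurable_funX.
- exact: L1_measurable.
- apply: (ae_on_imp _ (ae_on_and e1 e2)) => x _.
  by rewrite /abs2 => -[-> ->].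
Qed.

Lemma H2norm_sqr u p1 q1 p2 q2 : H2jet u p1 q1 p2 q2 ->
  let S x := (complex.Re (u x) ^+ 2 + complex.Im (u x) ^+ 2) + (p1 x ^+ 2 + q1 x ^+ 2)
    + (p2 x ^+ 2 + q2 x ^+ 2) in
  L1 l S /\ H2norm l u ^+ 2 = rint l S.
Proof.
move=> [hp hq hp1 hq1] S.
have [lp lp1 _] := hp; have [lq lq1 _] := hq; have [_ lp2 _] := hp1; have [_ lq2 _] := hq1.
have iS : L1 l S by have [[_ _ ?] [_ _ ?] [_ _ ?] [_ _ ?]] := And4 lp lq lp1 lq1;
  have [[_ _ ?] [_ _ ?]] := (lp2, lq2); apply: L1D; [apply: L1D|]; apply: L1D.
split=> //; rewrite /H2norm sqr_sqrtr; last first.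
  by apply: rint_ge0 => x _; rewrite /abs2 !addr_ge0 ?sqr_ge0.
have [h1 h2 e1 e2] := wderive_weak_deriv hp hq.
have [h3 h4 e3 e4] := wderive2_weak_deriv hp hq hp1 hq1.
have [[_ l1 _] [_ l2 _] [_ l3 _] [_ l4 _]] := And4 h1 h2 h3 h4.
apply: rint_ae.
- apply: measurable_funD; last exact: measurable_sqrD.
  by apply: measurable_funD; exact: measurable_sqrD.
- exact: L1_measurable.
- apply: (ae_on_imp _ (ae_on_and (ae_on_and e1 e2) (ae_on_and e3 e4))) => x _.
  by rewrite /abs2 /S => -[[-> ->] [-> ->]].
Qed.

End ComplexWeakDerivative.

(** * Second-order remainder of the functional *)

Section QuadraticBounds.
Context {R : realType} (T : Type).
Variables (D : T -> Prop) (S : T -> R).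
Hypothesis S0 : forall t, 0 <= S t.
Implicit Types f g : T -> R.

(* S is the squared size of the increment: the three classes are O(1), O(sqrt S)
   and O(S), uniformly over D. *)
Definition bounded_by f (h : T -> R) := exists C, forall t, D t -> `|f t| <= C * h t.
Definition order0 f := bounded_by f (fun=> 1).
Definition order1 f := bounded_by (fun t => f t ^+ 2) S.
Definition order2 f := bounded_by f S.

Lemma order0_cst c : order0 (fun=> c).
Proof. by exists `|c| => t _; rewrite mulr1. Qed.

Lemma bounded_byD f g h : bounded_by f h -> bounded_by g h ->
  bounded_by (fun t => f t + g t) h.
Proof.
move=> [C hf] [C' hg]; exists (C + C') => t Dt.
by rewrite (le_trans (ler_normD _ _))// mulrDl lerD ?hf ?hg.
Qed.

Lemma order0_mul f g h : order0 f -> bounded_by g h -> bounded_by (fun t => f t * g t) h.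
Proof.
move=> [C hf] [C' hg]; exists (C * C') => t Dt.
by rewrite normrM -mulrA ler_pM// ?hg// -[C]mulr1 hf.
Qed.

Lemma order1_add f g : order1 f -> order1 g -> order1 (fun t => f t + g t).
Proof.
move=> [C hf] [C' hg]; exists (2 * C + 2 * C') => t Dt.
move: (hf t Dt) (hg t Dt); rewrite !(ger0_norm (sqr_ge0 _)).
by have := sqr_ge0 (f t - g t); nra.
Qed.

Lemma order0_order1 f g : order0 f -> order1 g -> order1 (fun t => f t * g t).
Proof.
move=> hf hg; have := order0_mul (order0_mul hf hf) hg; rewrite /order1; congr bounded_by.
by apply/funext => t; rewrite exprMn expr2.
Qed.

Lemma order1_order1 f g : order1 f -> order1 g -> order2 (fun t => f t * g t).
Proof.
move=> [C hf] [C' hg]; exists (C + C') => t Dt.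
move: (hf t Dt) (hg t Dt); rewrite !(ger0_norm (sqr_ge0 _)) mulrDl ler_norml.
by have := sqr_ge0 (f t - g t); have := sqr_ge0 (f t + g t); nra.
Qed.

Lemma order1_sqr_le f : (forall t, f t ^+ 2 <= S t) -> order1 f.
Proof. by move=> h; exists 1 => t _; rewrite ger0_norm ?sqr_ge0// mul1r. Qed.

End QuadraticBounds.

(** * Expansion of the Lagrangian density to second order *)

Section Taylor.
Context {R : realType}.
Implicit Types k p q r s M : R.

(* First-order part of [lagrangian] in the increment (r, s). *)
Definition dlagrangian k p q p1 q1 p2 q2 r s r1 s1 r2 s2 : R :=
  let m := p ^+ 2 + q ^+ 2 - 1 in
  let n := p1 ^+ 2 + q1 ^+ 2 in
  let rho := p * p1 + q * q1 in
  (- 6 * p * n - 4 * rho * p1 + 3 * m ^+ 2 * p + 2 * k * m * p) * r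
  + (- 6 * q * n - 4 * rho * q1 + 3 * m ^+ 2 * q + 2 * k * m * q) * s
  + (- 6 * m * p1 - 4 * rho * p - 2 * k * p1) * r1
  + (- 6 * m * q1 - 4 * rho * q - 2 * k * q1) * s1
  + 2 * p2 * r2 + 2 * q2 * s2.

Lemma lagrangian_taylor k M : exists C, forall p q p1 q1 p2 q2 r s r1 s1 r2 s2,
  `|p| <= M -> `|q| <= M -> `|p1| <= M -> `|q1| <= M -> `|r| <= 1 -> `|s| <= 1 ->
  `|lagrangian k (p + r) (q + s) (p1 + r1) (q1 + s1) (p2 + r2) (q2 + s2)
    - lagrangian k p q p1 q1 p2 q2 - dlagrangian k p q p1 q1 p2 q2 r s r1 s1 r2 s2|
  <= C * ((r ^+ 2 + s ^+ 2) + (r1 ^+ 2 + s1 ^+ 2) + (r2 ^+ 2 + s2 ^+ 2)).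
Proof.
(* One vector holds all variables: entries 0 to 3 are [p, q, p1, q1], bounded by [M]; 4 and 5 are
   [r, s], bounded by 1; 6 to 9 are the increments of the derivatives, left unbounded. *)
pose T := nat -> R.
pose D (t : T) := forall i, (i < 6)%N -> `|t i| <= if (i < 4)%N then M else 1.
pose S (t : T) := (t 4 ^+ 2 + t 5 ^+ 2) + (t 6 ^+ 2 + t 7 ^+ 2) + (t 8 ^+ 2 + t 9 ^+ 2).
have S0 t : 0 <= S t by rewrite !addr_ge0 ?sqr_ge0.
have bD i : (i < 6)%N -> order0 D (fun t => t i).
  by move=> i6; exists (if (i < 4)%N then M else 1) => t /(_ i i6); rewrite mulr1.
have lS i : (3 < i < 10)%N -> order1 D S (fun t => t i).
  move=> hi; apply: order1_sqr_le => t; rewrite /S.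
  have := (sqr_ge0 (t 4), sqr_ge0 (t 5), sqr_ge0 (t 6), sqr_ge0 (t 7),
    sqr_ge0 (t 8), sqr_ge0 (t 9)).
  by case: i hi => [|[|[|[|[|[|[|[|[|[|i]]]]]]]]]]// _ [[[[[]]]]]; lra.
pose p (t : T) := t 0; pose q (t : T) := t 1; pose p1 (t : T) := t 2; pose q1 (t : T) := t 3.
pose r (t : T) := t 4; pose s (t : T) := t 5; pose r1 (t : T) := t 6; pose s1 (t : T) := t 7.
pose r2 (t : T) := t 8; pose s2 (t : T) := t 9.
have [bp bq bp1 bq1] : [/\ order0 D p, order0 D q, order0 D p1 & order0 D q1] by split; exact: bD.
have [br bs] : order0 D r /\ order0 D s by split; exact: bD.
have [lr ls lr1 ls1] : [/\ order1 D S r, order1 D S s, order1 D S r1 & order1 D S s1].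
  by split; exact: lS.
have [lr2 ls2] : order1 D S r2 /\ order1 D S s2 by split; exact: lS.
have bc c : order0 D (fun=> c : R) by exact: order0_cst.
pose m t := p t * p t + q t * q t + -1.
have bm : order0 D m.
  by rewrite /m; apply: bounded_byD (bc _); apply: bounded_byD; exact: order0_mul.
pose n t := p1 t * p1 t + q1 t * q1 t.
have bn : order0 D n by rewrite /n; apply: bounded_byD; exact: order0_mul.
pose rho t := p t * p1 t + q t * q1 t.
have brho : order0 D rho by rewrite /rho; apply: bounded_byD; exact: order0_mul.
(* The increment changes [m], [n], [rho] into [m + 2 la + om], [n + 2 la1 + om1] and
   [rho + tau + th], where [la, la1, tau] are linear in it and [om, om1, th] quadratic. *)
pose la t := p t * r t + q t * s t.
have lla : order1 D S la by rewrite /la; apply: order1_add => //; exact: order0_order1.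
have bla : order0 D la by rewrite /la; apply: bounded_byD; exact: order0_mul.
pose la1 t := p1 t * r1 t + q1 t * s1 t.
have lla1 : order1 D S la1 by rewrite /la1; apply: order1_add => //; exact: order0_order1.
pose om t := r t * r t + s t * s t.
have lom : order1 D S om by rewrite /om; apply: order1_add => //; exact: order0_order1.
have bom : order0 D om by rewrite /om; apply: bounded_byD; exact: order0_mul.
have qom : order2 D S om by rewrite /om; apply: bounded_byD; exact: order1_order1.
pose om1 t := r1 t * r1 t + s1 t * s1 t.
have qom1 : order2 D S om1 by rewrite /om1; apply: bounded_byD; exact: order1_order1.
pose om2 t := r2 t * r2 t + s2 t * s2 t.
have qom2 : order2 D S om2 by rewrite /om2; apply: bounded_byD; exact: order1_order1.
pose tau t := (p t * r1 t + p1 t * r t) + (q t * s1 t + q1 t * s t).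
have ltau : order1 D S tau.
  by rewrite /tau; apply: order1_add => //; apply: order1_add => //; exact: order0_order1.
pose th t := r t * r1 t + s t * s1 t.
have lth : order1 D S th by rewrite /th; apply: order1_add => //; exact: order0_order1.
have qth : order2 D S th by rewrite /th; apply: bounded_byD; exact: order1_order1.
(* [e] is the second-order remainder of the density of the energy E; [f3], [f2] and [f6] below are
   those of [m n], [rho^2] and [m^3]. *)
pose e t := om1 t + -2^-1 * (4 * (la t * la t) + 2 * (m t * om t) + 4 * (la t * om t) +
  om t * om t).
have qe : order2 D S e.
  rewrite /e; apply: bounded_byD => //; apply: order0_mul (bc _) _.
  apply: bounded_byD; last exact: order0_mul.
  apply: bounded_byD; last by apply: order0_mul (bc _) _; exact: order0_mul.
  apply: bounded_byD; last by apply: order0_mul (bc _) _; exact: order0_mul.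
  by apply: order0_mul (bc _) _; exact: order1_order1.
pose f3 t := (m t * om1 t + 4 * (la t * la1 t)) + (2 * (la t * om1 t) + om t * (n t))
  + (2 * (om t * la1 t) + om t * om1 t).
have qf3 : order2 D S f3.
  rewrite /f3; apply: bounded_byD; [apply: bounded_byD|]; apply: bounded_byD.
  - exact: order0_mul.
  - by apply: order0_mul (bc _) _; exact: order1_order1.
  - by apply: order0_mul (bc _) _; exact: order0_mul.
  - by under eq_fun do rewrite mulrC; exact: order0_mul.
  - by apply: order0_mul (bc _) _; exact: order1_order1.
  - exact: order0_mul.
pose f2 t := (tau t * tau t + th t * th t) + 2 * (rho t * th t + tau t * th t).
have qf2 : order2 D S f2.
  rewrite /f2; apply: bounded_byD; first by apply: bounded_byD; exact: order1_order1.
  apply: order0_mul (bc _) _; apply: bounded_byD; first exact: order0_mul.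
  exact: order1_order1.
pose f6 t := (12 * (m t * (la t * la t)) + 3 * ((m t * m t) * om t)) +
  ((8 * (la t * (la t * la t)) + 12 * (la t * (la t * om t))) +
   (6 * (la t * (om t * om t)) + (om t * (om t * om t) +
    (3 * (m t * (om t * om t)) + 12 * (m t * (la t * om t)))))).
have qf6 : order2 D S f6.
  rewrite /f6; have qll : order2 D S (fun t => la t * la t) by exact: order1_order1.
  have qlo : order2 D S (fun t => la t * om t) by exact: order1_order1.
  have qoo : order2 D S (fun t => om t * om t) by exact: order1_order1.
  have bmm : order0 D (fun t => m t * m t) by exact: order0_mul.
  by repeat first [exact: order0_mul | apply: bounded_byD | apply: order0_mul (bc _) _].
have [C hC] : order2 D S (fun t => (om2 t + -3 * f3 t) + (-2 * f2 t + (2^-1 * f6 t + - k * e t))).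
  by repeat first [exact: qom2 | exact: order0_mul | apply: bounded_byD].
exists C => p' q' p1' q1' p2' q2' r' s' r1' s1' r2' s2' hp hq hp1 hq1 hr hs.
have := hC (fun i => nth 0 [:: p'; q'; p1'; q1'; r'; s'; r1'; s1'; r2'; s2'] i).
rewrite {1}/D => h; apply: le_trans (h _); last first.
  by case=> [|[|[|[|[|[|]]]]]].
rewrite le_eqVlt; apply/orP; left; apply/eqP; congr `|_|.
rewrite /lagrangian /dlagrangian /f3 /f2 /f6 /e /th /tau /om2 /om1 /om /la1 /la /rho.
rewrite /n /m /p /q /p1 /q1 /r /s /r1 /s1 /r2 /s2 /=.
by field.
Qed.
End Taylor.

(** * Test functions and first variations *)

Section TestAlgebra.
Context {R : realType}.
Variable l : R.
Hypothesis l0 : 0 < l.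
Implicit Types (f g dg : R -> R) (x : R).

(** Designed for a generator such as [g = 1 / den], whose derivative is a test function times [g^2]:
    the algebra is then closed under differentiation, without a quotient rule for higher
    derivatives. *)
Inductive test_algebra g : (R -> R) -> Prop :=
| test_algebra_gen : test_algebra g g
| test_algebra_base f of test_function l f : test_algebra g f
| test_algebra_add f1 f2 of test_algebra g f1 & test_algebra g f2 :
    test_algebra g (fun x => f1 x + f2 x)
| test_algebra_mul f1 f2 of test_algebra g f1 & test_algebra g f2 :
    test_algebra g (fun x => f1 x * f2 x).

Lemma test_algebra_test g dg : (forall x, g (x + l) = g x) -> has_deriv g dg -> test_algebra g dg ->
  forall f, test_algebra g f -> test_function l f.
Proof.
move=> gper hg sdg f sf; split.
  elim: sf => [//|{}f [+ _] x|f1 f2 _ h1 _ h2 x|f1 f2 _ h1 _ h2 x]; first exact.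
    by rewrite h1 h2.
  by rewrite h1 h2.
apply: (smooth_of_closed (C := test_algebra g)) sf => {}f.
elim=> [|{}f tf|f1 f2 _ [d1 s1 h1] _ [d2 s2 h2]|f1 f2 sf1 [d1 s1 h1] sf2 [d2 s2 h2]].
- by exists dg.
- exists (derive1 f); last exact: test_deriv tf.
  by apply: test_algebra_base; exact: test_derive1.
- by eexists; [exact: test_algebra_add s1 s2|exact: has_deriv_add].
- eexists; last exact: has_deriv_mul h1 h2.
  by apply: test_algebra_add; exact: test_algebra_mul.
Qed.

Lemma test_salg0 f : test_algebra (fun=> 0) f -> test_function l f.
Proof.
by apply: (@test_algebra_test _ (fun=> 0)) => //; [exact: has_deriv_cst|exact: test_algebra_gen].
Qed.

Lemma test_add f g : test_function l f -> test_function l g ->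
  test_function l (fun x => f x + g x).
Proof. by move=> hf hg; apply: test_salg0; apply: test_algebra_add; exact: test_algebra_base. Qed.

Lemma test_mul f g : test_function l f -> test_function l g ->
  test_function l (fun x => f x * g x).
Proof. by move=> hf hg; apply: test_salg0; apply: test_algebra_mul; exact: test_algebra_base. Qed.

Lemma test_scale c f : test_function l f -> test_function l (fun x => c * f x).
Proof. by move=> hf; exact (test_mul (test_cst l0 c) hf). Qed.

Lemma test_has_deriv f df : test_function l f -> has_deriv f df -> test_function l df.
Proof. by move=> hf /has_deriv_derive1 <-; exact: test_derive1. Qed.

Lemma weak_deriv_has_deriv f df : test_function l f -> has_deriv f df -> weak_deriv l f df.
Proof. by move=> hf /has_deriv_derive1 <-; exact: weak_deriv_test. Qed.

Lemma rint_weak r r1 f df : weak_deriv l r r1 -> test_function l f -> has_deriv f df ->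
  rint l (fun x => f x * r1 x) = - rint l (fun x => df x * r x).
Proof.
move=> [_ _ h] tf /has_deriv_derive1 <-.
under [in RHS]eq_rint do rewrite mulrC.
by under eq_rint do rewrite mulrC; rewrite (h f tf) opprK.
Qed.

Lemma rint_euler_lagrange f0 f1 df1 f2 df2 ddf2 r r1 r2 :
  weak_deriv l r r1 -> weak_deriv l r1 r2 -> test_function l f0 -> test_function l f1 ->
  test_function l f2 -> has_deriv f1 df1 -> has_deriv f2 df2 -> has_deriv df2 ddf2 ->
  (forall x, f0 x - df1 x + ddf2 x = 0) ->
  L1 l (fun x => f0 x * r x + f1 x * r1 x + f2 x * r2 x) /\
  rint l (fun x => f0 x * r x + f1 x * r1 x + f2 x * r2 x) = 0.
Proof.
move=> hr hr1 t0 t1 t2 h1 h2 h3 el.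
have tdf2 := test_has_deriv t2 h2; have tddf2 := test_has_deriv tdf2 h3.
have tdf1 := test_has_deriv t1 h1.
have [lr lr1 _] := hr; have [_ lr2 _] := hr1.
have i (f r' : R -> R) : test_function l f -> L2_periodic l r' -> L1 l (fun x => f x * r' x).
  by move=> tf hr'; exact: L2_periodic_L1M (test_L2_periodic l0 tf) hr'.
have i01 := L1D (i _ _ t0 lr) (i _ _ t1 lr1).
split; first exact: L1D (i _ _ _ _).
rewrite rintD//; last exact: i.
rewrite rintD//; [|exact: i..].
rewrite (rint_weak hr t1 h1) (rint_weak hr1 t2 h2) (rint_weak hr tdf2 h3) opprK.
rewrite -rintB; [|exact: i..].
rewrite -rintD; [|by apply: L1B; exact: i|exact: i].
rewrite (@eq_rint _ _ _ (fun=> 0)); first by rewrite rint_cst ?mul0r// ltW.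
by move=> x _; rewrite -mulrBl -mulrDl el mul0r.
Qed.

End TestAlgebra.

(* Half of the Euler-Lagrange expression; it is the real part of the fourth-order
   ODE, and exchanging the roles of p and q gives the imaginary part. *)
Definition euler_lagrange {R : realType} (k p q p1 q1 p2 q2 p4 : R) : R :=
  let m := p ^+ 2 + q ^+ 2 - 1 in
  p4 + 3 * m * p2 + 6 * (p * p1 + q * q1) * p1 + 2 * (p * p2 + q * q2) * p
  - (p1 ^+ 2 + q1 ^+ 2) * p + 3 / 2 * m ^+ 2 * p + k * (p2 + m * p).

Section FirstVariation.
Context {R : realType}.
Variables (l k : R) (p q p1 q1 p2 q2 p3 p4 : R -> R).
Hypotheses (l0 : 0 < l) (tp : test_function l p) (tq : test_function l q).
Hypotheses (hp : has_deriv p p1) (hp1 : has_deriv p1 p2) (hp2 : has_deriv p2 p3)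
  (hp3 : has_deriv p3 p4) (hq : has_deriv q q1) (hq1 : has_deriv q1 q2).

(** [dlagrangian] is linear in the increment and symmetric under exchange of real and imaginary
    parts, so this case, with zero imaginary increment, also yields the other half once [p] and [q]
    are exchanged. *)
Lemma rint_dlagrangian_half (r r1 r2 : R -> R) :
  (forall x, euler_lagrange k (p x) (q x) (p1 x) (q1 x) (p2 x) (q2 x) (p4 x) = 0) ->
  weak_deriv l r r1 -> weak_deriv l r1 r2 ->
  let h x := dlagrangian k (p x) (q x) (p1 x) (q1 x) (p2 x) (q2 x) (r x) 0 (r1 x) 0 (r2 x) 0 in
  L1 l h /\ rint l h = 0.
Proof.
move=> el hr hr1 h.
have tp1 := test_has_deriv tp hp; have tq1 := test_has_deriv tq hq.
have tp2 := test_has_deriv tp1 hp1.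
pose m x := p x * p x + q x * q x + -1.
have hm := has_deriv_add (has_deriv_add (has_deriv_mul hp hp) (has_deriv_mul hq hq))
  (has_deriv_cst (-1)).
have hrho := has_deriv_add (has_deriv_mul hp hp1) (has_deriv_mul hq hq1).
have tm : test_function l m :=
  test_add (test_add (test_mul tp tp) (test_mul tq tq)) (test_cst l0 (-1)).
have trho := test_add (test_mul tp tp1) (test_mul tq tq1).
have tn := test_add (test_mul tp1 tp1) (test_mul tq1 tq1).
have hf1 := has_deriv_add (has_deriv_add (has_deriv_scale (-6) (has_deriv_mul hm hp1))
   (has_deriv_scale (-4) (has_deriv_mul hrho hp))) (has_deriv_scale (-2 * k) hp1).
have hf2 := has_deriv_scale 2 hp2.
pose f0 x := -6 * (p x * (p1 x * p1 x + q1 x * q1 x)) + -4 * ((p x * p1 x + q x * q1 x) * p1 x)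
  + 3 * (m x * m x * p x) + 2 * k * (m x * p x).
have tf0 : test_function l f0 := test_add (test_add (test_add
  (test_scale l0 (-6) (test_mul tp tn)) (test_scale l0 (-4) (test_mul trho tp1)))
  (test_scale l0 3 (test_mul (test_mul tm tm) tp))) (test_scale l0 (2 * k) (test_mul tm tp)).
have tf1 := test_add (test_add (test_scale l0 (-6) (test_mul tm tp1))
  (test_scale l0 (-4) (test_mul trho tp))) (test_scale l0 (-2 * k) tp1).
have [|i1 i2] := rint_euler_lagrange l0 hr hr1 tf0 tf1 (test_scale l0 2 tp2) hf1
  (has_deriv_scale 2 hp2) (has_deriv_scale 2 hp3).
- move=> x; rewrite [RHS](_ : 0 = 2 * 0); last by rewrite mulr0.
  by rewrite -[in RHS](el x) /euler_lagrange /f0 /m; field.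
have e : h = (fun x => f0 x * r x +
    (-6 * ((p x * p x + q x * q x + -1) * p1 x) + -4 * ((p x * p1 x + q x * q1 x) * p x) +
     -2 * k * p1 x) * r1 x
    + 2 * p2 x * r2 x).
  by apply/funext => x; rewrite /h /dlagrangian /f0 /m; ring.
by rewrite e.
Qed.
End FirstVariation.

Lemma le_rint_ae {R : realType} (l : R) (f g : R -> R) : L1 l f -> L1 l g ->
  ae_on l (fun x => f x <= g x) -> rint l f <= rint l g.
Proof.
move=> hf hg h; have [mf mg] := (L1_measurable hf, L1_measurable hg).
have mfg : measurable_fun `[0, l] (fun x => Num.min (f x) (g x)) by exact: measurable_minr.
rewrite (@rint_ae _ _ f (fun x => Num.min (f x) (g x))) //; last first.
  by apply: (ae_on_imp _ h) => x _ fg; rewrite min_l.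
apply: le_rint => // [|x _]; last by rewrite ge_min lexx orbT.
apply: (L1_le mfg (L1D (L1_norm hf) (L1_norm hg))) => x _.
by have [_|_] := leP (f x) (g x); rewrite ?lerDl ?lerDr.
Qed.

Lemma H2jet_add {R : realType} (l : R) (u w : R -> R[i]) p1 q1 p2 q2 r1 s1 r2 s2 : 0 < l ->
  H2jet l u p1 q1 p2 q2 -> H2jet l w r1 s1 r2 s2 ->
  H2jet l (fun x => u x + w x) (fun x => p1 x + r1 x) (fun x => q1 x + s1 x)
    (fun x => p2 x + r2 x) (fun x => q2 x + s2 x).
Proof.
move=> l0 [h1 h2 h3 h4] [k1 k2 k3 k4]; split; [| |exact: weak_deriv_add..].
  have := weak_deriv_add l0 h1 k1; congr weak_deriv; apply/funext => x.
  by case: (u x) => a b; case: (w x).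
have := weak_deriv_add l0 h2 k2; congr weak_deriv; apply/funext => x.
by case: (u x) => a b; case: (w x).
Qed.

Lemma ReMl {R : realType} (c : R) (z : R[i]) : complex.Re (c%:C * z) = c * complex.Re z.
Proof. by rewrite [c%:C * z]mulrC ReMr mulrC. Qed.

Lemma ImMl {R : realType} (c : R) (z : R[i]) : complex.Im (c%:C * z) = c * complex.Im z.
Proof. by rewrite [c%:C * z]mulrC ImMr mulrC. Qed.

Lemma H2jet_scale {R : realType} (l : R) c (w : R -> R[i]) r1 s1 r2 s2 : 0 < l ->
  H2jet l w r1 s1 r2 s2 ->
  H2jet l (fun x => c%:C * w x) (fun x => c * r1 x) (fun x => c * s1 x)
    (fun x => c * r2 x) (fun x => c * s2 x).
Proof.
move=> l0 [k1 k2 k3 k4]; split; [| |exact: weak_deriv_scale..].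
  have := weak_deriv_scale l0 c k1; congr weak_deriv; apply/funext => x.
  by rewrite ReMl.
have := weak_deriv_scale l0 c k2; congr weak_deriv; apply/funext => x.
by rewrite ImMl.
Qed.

Lemma H2norm_ge0 {R : realType} (l : R) u : 0 <= H2norm l u.
Proof. exact: sqrtr_ge0. Qed.

Lemma H2norm_scale {R : realType} (l : R) c w : 0 < l -> 0 <= c -> H2per l w ->
  H2norm l (fun x => c%:C * w x) = c * H2norm l w.
Proof.
move=> l0 c0 /(H2perP l0) jw; have [iS eS] := H2norm_sqr l0 jw.
have [_ eS'] := H2norm_sqr l0 (H2jet_scale c l0 jw).
apply/eqP; rewrite -(@eqrXn2 _ 2)// ?mulr_ge0 ?H2norm_ge0//.
rewrite eS' exprMn eS -rintZ//; apply/eqP/eq_rint => x _ /=.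
by rewrite ReMl ImMl; ring.
Qed.

(* The zero functional is a first variation, and a first variation is unique
   because it is homogeneous while the error term is quadratic. *)
Lemma critical_point_of_quadratic {R : realType} (l C d : R) Phi u : 0 < l ->
  H2per l u -> 0 < d ->
  (forall w, H2per l w -> H2norm l w <= d ->
    `|Phi (fun x => u x + w x) - Phi u| <= C * H2norm l w ^+ 2) ->
  is_critical_point l Phi u.
Proof.
move=> l0 hu d0 hC; split=> //.
  exists (fun=> 0); split; first by move=> *; rewrite mulr0 addr0.
  by exists C, d; split=> // w hw hwd; rewrite subr0; exact: hC.
move=> D [linD [C' [d' [d'0 hC']]]] w hw.
have H0 : H2per l (fun=> 0 : R[i]).
  have h0 : weak_deriv l (fun=> 0) (fun=> 0).
    by have := weak_deriv_test l0 (test_cst l0 0); rewrite (has_deriv_derive1 (has_deriv_cst _)).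
  exact: (@H2jet_H2per _ _ _ (fun=> 0) (fun=> 0) (fun=> 0) (fun=> 0)).
(* [real_linear_H2] speaks of [c v + w] only; homogeneity follows by taking [w = 0], once [D] is
   known to vanish at zero. *)
have D0 : D (fun=> 0) = 0.
  have := linD 1 _ _ H0 H0; under [X in D X]eq_fun do rewrite mulr0 addr0.
  lra.
have DZ c : D (fun x => c%:C * w x) = c * D w.
  have := linD c _ _ hw H0; under [X in D X]eq_fun do rewrite addr0.
  by rewrite D0 addr0.
pose h := H2norm l w.
have hge0 : 0 <= h := H2norm_ge0 _ _.
(* Applied to [e w], both estimates are quadratic in [e] while [D] is linear; dividing by [e] leaves
   one factor [e] on the right. *)
have key e : 0 < e -> e * h <= d -> e * h <= d' -> `|D w| <= (C + C') * h ^+ 2 * e.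
  move=> e0 he he'.
  have hew : H2per l (fun x => e%:C * w x).
    exact: H2jet_H2per (H2jet_scale e l0 (H2perP l0 hw)).
  have ne := H2norm_scale l0 (ltW e0) hw; rewrite -/h in ne.
  have := hC _ hew; have := hC' _ hew; rewrite ne => /(_ he') h1 /(_ he) h2.
  rewrite DZ in h1; rewrite -(ler_pM2l e0) -{1}(gtr0_norm e0) -normrM.
  have := ler_normB (Phi (fun x => u x + e%:C * w x) - Phi u)
    (Phi (fun x => u x + e%:C * w x) - Phi u - e * D w).
  rewrite opprB addrC subrK; nra.
apply/eqP; rewrite -normr_le0 leNgt; apply/negP => Dw.
pose K := `|(C + C') * h ^+ 2| + 1.
have K0 : 0 < K by rewrite ltr_wpDl.
(* Small enough for both estimates to apply to [e w] and for [K e] to be at most half of [|D w|];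
   the added 1 in [h + 1] covers [h = 0]. *)
pose e := Num.min (Num.min d d' / (h + 1)) (`|D w| / (2 * K)).
have h1 : 0 < h + 1 by rewrite ltr_wpDl.
have dd0 : 0 < Num.min d d' by rewrite lt_min d0.
have e0 : 0 < e by rewrite lt_min !divr_gt0// mulr_gt0.
have eh : e * h <= Num.min d d'.
  rewrite (@le_trans _ _ (e * (h + 1)))//; first by rewrite ler_pM2l// lerDl.
  by rewrite -ler_pdivlMr// ge_min lexx.
have := key _ e0; rewrite !(le_trans eh) ?ge_min ?lexx ?orbT// => /(_ isT isT).
apply/negP; rewrite -ltNge (@le_lt_trans _ _ (K * e))//.
  by rewrite ler_pM2r// (le_trans (ler_norm _))// lerDl.
rewrite (@le_lt_trans _ _ (K * (`|D w| / (2 * K))))//.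
  by rewrite ler_pM2l// ge_min lexx orbT.
by rewrite (_ : _ * _ = `|D w| / 2); [lra|field; rewrite gt_eqF].
Qed.

(** * Critical points from the Euler-Lagrange equation *)

Section CriticalPoint.
Context {R : realType}.
Variables (l k : R) (p q p1 q1 p2 q2 p3 q3 p4 q4 : R -> R).
Hypotheses (l0 : 0 < l) (tp : test_function l p) (tq : test_function l q).
Hypotheses (hp : has_deriv p p1) (hp1 : has_deriv p1 p2) (hp2 : has_deriv p2 p3)
  (hp3 : has_deriv p3 p4).
Hypotheses (hq : has_deriv q q1) (hq1 : has_deriv q1 q2) (hq2 : has_deriv q2 q3)
  (hq3 : has_deriv q3 q4).
Hypothesis elp : forall x, euler_lagrange k (p x) (q x) (p1 x) (q1 x) (p2 x) (q2 x) (p4 x) = 0.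
Hypothesis elq : forall x, euler_lagrange k (q x) (p x) (q1 x) (p1 x) (q2 x) (p2 x) (q4 x) = 0.

Lemma rint_dlagrangian w r1 s1 r2 s2 : H2jet l w r1 s1 r2 s2 ->
  let h x := dlagrangian k (p x) (q x) (p1 x) (q1 x) (p2 x) (q2 x)
    (complex.Re (w x)) (complex.Im (w x)) (r1 x) (s1 x) (r2 x) (s2 x) in
  L1 l h /\ rint l h = 0.
Proof.
move=> [hr hs hr1 hs1] h.
have [ir er] := rint_dlagrangian_half l0 tp tq hp hp1 hp2 hp3 hq hq1 elp hr hr1.
have [is_ es] := rint_dlagrangian_half l0 tq tp hq hq1 hq2 hq3 hp hp1 elq hs hs1.
have -> : h = fun x => dlagrangian k (p x) (q x) (p1 x) (q1 x) (p2 x) (q2 x)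
    (complex.Re (w x)) 0 (r1 x) 0 (r2 x) 0 +
  dlagrangian k (q x) (p x) (q1 x) (p1 x) (q2 x) (p2 x) (complex.Im (w x)) 0 (s1 x) 0 (s2 x) 0.
  by apply/funext => x; rewrite /h /dlagrangian; ring.
by split; [exact: L1D|rewrite rintD// er es addr0].
Qed.

Lemma test_bounded phi : test_function l phi ->
  exists M, forall x, 0 <= x <= l -> `|phi x| <= M.
Proof. by move=> /test_abs_cont h; eexists => x; exact: (abs_cont_bounded h). Qed.

Lemma euler_lagrange_critical_point :
  is_critical_point l (fun u => energyF l u - k * energyE l u) (fun x => p x +i* q x).
Proof.
set u : R -> R[i] := fun x => _; set Phi := fun u => _.
have tp1 := test_has_deriv tp hp; have tq1 := test_has_deriv tq hq.
have ju : H2jet l u p1 q1 p2 q2.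
  split; [exact: (weak_deriv_has_deriv l0 tp hp)|exact: (weak_deriv_has_deriv l0 tq hq)|
          exact: (weak_deriv_has_deriv l0 tp1 hp1)|exact: (weak_deriv_has_deriv l0 tq1 hq1)].
have [[Mp bp] [Mq bq]] := (test_bounded tp, test_bounded tq).
have [[Mp1 bp1] [Mq1 bq1]] := (test_bounded tp1, test_bounded tq1).
pose M := `|Mp| + `|Mq| + (`|Mp1| + `|Mq1|).
have leM : [/\ Mp <= M, Mq <= M, Mp1 <= M & Mq1 <= M].
  have := (ler_norm Mp, ler_norm Mq, ler_norm Mp1, ler_norm Mq1).
  have := (normr_ge0 Mp, normr_ge0 Mq, normr_ge0 Mp1, normr_ge0 Mq1).
  by rewrite /M => -[[[]]] ? ? ? ? [[[]]] ? ? ? ?; split; lra.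
have [C0 hC0] := lagrangian_taylor k M.
pose C := `|C0|.
pose K := l^-1 + 2.
have K0 : 0 < K by rewrite addr_gt0// invr_gt0.
(* [K] is the constant of [weak_deriv_sup]; with this radius the squared sup bound [K * d ^+ 2] is
   at most 1, as [lagrangian_taylor] requires of [r] and [s]. *)
pose d := (1 + K)^-1.
have d0 : 0 < d by rewrite invr_gt0; lra.
have Kd : K * d ^+ 2 <= 1.
  have -> : K * d ^+ 2 = K / (1 + K) ^+ 2 by rewrite /d exprVn.
  by rewrite ler_pdivrMr ?exprn_gt0; nra.
apply: (@critical_point_of_quadratic _ _ C d) => //; first exact: H2jet_H2per ju.
move=> w /(H2perP l0) jw wd.
have juw := H2jet_add l0 ju jw.
have [iu eu] := energies_rint l0 k ju; have [iuw euw] := energies_rint l0 k juw.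
have [iS eS] := H2norm_sqr l0 jw.
have [idh edh] := rint_dlagrangian jw.
move: jw => [jw1 jw2 _ _].
have [Sr Ss] : ae_on l (fun x => `|complex.Re (w x)| <= 1) /\
    ae_on l (fun x => `|complex.Im (w x)| <= 1).
  have sup (r r1 : R -> R) : weak_deriv l r r1 ->
      rint l (fun x => r x ^+ 2 + r1 x ^+ 2) <= H2norm l w ^+ 2 -> ae_on l (fun x => `|r x| <= 1).
    move=> /(weak_deriv_sup l0) h hr; apply: (ae_on_imp _ h) => x _ hx.
    rewrite -(@ler_pXn2r _ 2)// ?nnegrE// real_normK ?num_real// expr1n (le_trans hx)//.
    rewrite (le_trans _ Kd)// ler_pM2l// (le_trans hr)//.
    by rewrite ler_pXn2r// nnegrE ?H2norm_ge0// ltW.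
  have [[[_ _ ?] [_ _ ?] _] [[_ _ ?] [_ _ ?] _]] := (jw1, jw2).
  have le6 (e0 e1 e2 e3 e4 e5 : R) :
      e0 ^+ 2 + e2 ^+ 2 <= e0 ^+ 2 + e1 ^+ 2 + (e2 ^+ 2 + e3 ^+ 2) + (e4 ^+ 2 + e5 ^+ 2) /\
      e1 ^+ 2 + e3 ^+ 2 <= e0 ^+ 2 + e1 ^+ 2 + (e2 ^+ 2 + e3 ^+ 2) + (e4 ^+ 2 + e5 ^+ 2).
    have := (sqr_ge0 e0, sqr_ge0 e1, sqr_ge0 e2, sqr_ge0 e3, sqr_ge0 e4, sqr_ge0 e5).
    by move=> [[[[[]]]]]; lra.
  split; [apply: sup jw1 _|apply: sup jw2 _]; rewrite eS; apply: le_rint => //.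
  - exact: L1D.
  - by move=> x _; exact: (le6 _ _ _ _ _ _).1.
  - exact: L1D.
  - by move=> x _; exact: (le6 _ _ _ _ _ _).2.
(* Subtracting the integral of the linear term, which is zero, leaves the integral of the pointwise
   Taylor remainder. *)
rewrite /Phi euw eu eS -[X in `|X|]subr0 -edh -rintB// -rintB//; last exact: L1B.
rewrite (le_trans (ler_norm_rint _))//; first by apply: L1B => //; exact: L1B.
rewrite -rintZ//; apply: le_rint_ae.
- by apply: L1_norm; apply: L1B => //; exact: L1B.
- exact: L1Z.
apply: (ae_on_imp _ (ae_on_and Sr Ss)) => x xl [hr hs].
have [h1 h2] : `|p x| <= M /\ `|q x| <= M.
  by case: leM => M1 M2 _ _; split; [exact: le_trans (bp x xl) M1|exact: le_trans (bq x xl) M2].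
have [h3 h4] : `|p1 x| <= M /\ `|q1 x| <= M.
  by case: leM => _ _ M1 M2; split; [exact: le_trans (bp1 x xl) M1|exact: le_trans (bq1 x xl) M2].
have := hC0 _ _ _ _ (p2 x) (q2 x) _ _ (complex.Re (wderive l w x)) (complex.Im (wderive l w x))
  (complex.Re (wderive l (wderive l w) x)) (complex.Im (wderive l (wderive l w) x))
  h1 h2 h3 h4 hr hs.
have -> : complex.Re (u x + w x) = p x + complex.Re (w x) by case: (w x).
have -> : complex.Im (u x + w x) = q x + complex.Im (w x) by case: (w x).
move=> /le_trans; apply; rewrite ler_wpM2r ?ler_norm//.
by rewrite !addr_ge0 ?sqr_ge0.
Qed.

End CriticalPoint.

(** * The breather *)

Section Profile.
Context {R : realType}.

(* Values of g'' and g'''' obtained by differentiating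
   g'^2 = - (E/2) g^4 - 2 M g^3 - k g^2. *)
Definition profile2 (E M k g : R) : R := - E * g ^+ 3 - 3 * M * g ^+ 2 - k * g.
Definition profile4 (E M k g g1 : R) : R :=
  (- 6 * E * g - 6 * M) * g1 ^+ 2 + (- 3 * E * g ^+ 2 - 6 * M * g - k) * profile2 E M k g.

(** The hypotheses give [|u|^2 - 1 = 2 M g + E g^2]. After elimination of [g1 ^+ 2] the expression
    is a combination of [p0] and [P] with coefficients polynomial in [g], and both coefficients
    vanish identically. *)
Lemma euler_lagrange_profile (E M k p0 q0 P Q g g1 : R) :
  p0 ^+ 2 + q0 ^+ 2 = 1 -> p0 * P + q0 * Q = M -> P ^+ 2 + Q ^+ 2 = E ->
  g1 ^+ 2 = - (E / 2) * g ^+ 4 - 2 * M * g ^+ 3 - k * g ^+ 2 ->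
  euler_lagrange k (p0 + P * g) (q0 + Q * g) (P * g1) (Q * g1)
    (P * profile2 E M k g) (Q * profile2 E M k g) (P * profile4 E M k g g1) = 0.
Proof.
move=> e1 eM eE eg; rewrite /euler_lagrange.
have -> : (p0 + P * g) ^+ 2 + (q0 + Q * g) ^+ 2 - 1 = 2 * M * g + E * g ^+ 2.
  rewrite -eM -eE [LHS](_ : _ = p0 ^+ 2 + q0 ^+ 2 - 1 +
    (2 * (p0 * P + q0 * Q) * g + (P ^+ 2 + Q ^+ 2) * g ^+ 2)); last by ring.
  by rewrite e1 subrr add0r.
have -> : (p0 + P * g) * (P * g1) + (q0 + Q * g) * (Q * g1) = (M + E * g) * g1.
  by rewrite -eM -eE; ring.
have -> : (p0 + P * g) * (P * profile2 E M k g) + (q0 + Q * g) * (Q * profile2 E M k g) =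
    (M + E * g) * profile2 E M k g.
  by rewrite -eM -eE; ring.
have -> : (P * g1) ^+ 2 + (Q * g1) ^+ 2 = E * g1 ^+ 2 by rewrite -eE; ring.
have -> : 6 * ((M + E * g) * g1) * (P * g1) = 6 * (M + E * g) * P * g1 ^+ 2 by ring.
by rewrite /profile4 /profile2 eg; field.
Qed.

Lemma profile2_deriv E M k (g g1 : R -> R) : has_deriv g g1 ->
  has_deriv (fun x => profile2 E M k (g x))
    (fun x => (- 3 * E * g x ^+ 2 - 6 * M * g x - k) * g1 x).
Proof.
move=> hg; have hg2 := has_deriv_mul hg hg; have hg3 := has_deriv_mul hg hg2.
have := has_deriv_add (has_deriv_add (has_deriv_scale (- E) hg3)
  (has_deriv_scale (- 3 * M) hg2)) (has_deriv_scale (- k) hg).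
by congr has_deriv; apply/funext => x; rewrite /profile2; ring.
Qed.

Lemma profile3_deriv E M k (g g1 : R -> R) : has_deriv g g1 ->
  has_deriv g1 (fun x => profile2 E M k (g x)) ->
  has_deriv (fun x => (- 3 * E * g x ^+ 2 - 6 * M * g x - k) * g1 x)
    (fun x => profile4 E M k (g x) (g1 x)).
Proof.
move=> hg hg1; have hg2 := has_deriv_mul hg hg.
have := has_deriv_mul (has_deriv_add (has_deriv_add (has_deriv_scale (- 3 * E) hg2)
  (has_deriv_scale (- 6 * M) hg)) (has_deriv_cst (- k))) hg1.
by congr has_deriv; apply/funext => x; rewrite /profile4; ring.
Qed.

Lemma has_deriv_affine p0 P (g g1 : R -> R) : has_deriv g g1 ->
  has_deriv (fun x => p0 + P * g x) (fun x => P * g1 x).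
Proof.
move=> hg; have := has_deriv_add (has_deriv_cst p0) (has_deriv_scale P hg).
by congr has_deriv; apply/funext => x; rewrite add0r.
Qed.

End Profile.

Lemma cderiveE {R : realType} (f f' u v : R -> R) : has_deriv f u -> has_deriv f' v ->
  cderive (fun x => f x +i* f' x) = (fun x => u x +i* v x) /\
  forall x, cderivable (fun x => f x +i* f' x) x.
Proof.
move=> h h'; rewrite /cderive /cderivable /= (has_deriv_derive1 h) (has_deriv_derive1 h').
by split=> // x; split; [exact: has_deriv_derivable h|exact: has_deriv_derivable h'].
Qed.

Lemma euler_lagrange_complex {R : realType} (k p q p1 q1 p2 q2 p4 q4 : R) :
  euler_lagrange k p q p1 q1 p2 q2 p4 = 0 -> euler_lagrange k q p q1 p1 q2 p2 q4 = 0 ->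
  (p4 +i* q4) + 3 * (p1 +i* q1) ^+ 2 * conjc (p +i* q)
  + (4 * (abs2 (p +i* q))%:C - 3) * (p2 +i* q2)
  + (p +i* q) ^+ 2 * conjc (p2 +i* q2)
  + 2 * (abs2 (p1 +i* q1))%:C * (p +i* q)
  + 3 / 2 * ((abs2 (p +i* q))%:C - 1) ^+ 2 * (p +i* q)
  + k%:C * ((p2 +i* q2) + ((abs2 (p +i* q))%:C - 1) * (p +i* q)) = 0.
Proof.
move=> ep eq.
(* Numerals are written as real scalars so that real and imaginary parts compute. *)
have n2 : 2 = 2%:C :> R[i] by rewrite rmorph_nat.
have n3 : 3 = 3%:C :> R[i] by rewrite rmorph_nat.
have n4 : 4 = 4%:C :> R[i] by rewrite rmorph_nat.
have h : 3 / 2 = (3 / 2)%:C :> R[i] by rewrite n2 n3 -fmorphV -rmorphM.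
rewrite h n2 n3 n4 /abs2 /= !expr2.
apply/complex_eqP; split.
  by apply: etrans ep; rewrite /euler_lagrange /=; field.
by apply: etrans eq; rewrite /euler_lagrange /=; field.
Qed.

(** * Parameter relations and explicit profile of the breather *)

Section Breather.
Context {R : realType}.
Variables (a alpha beta t : R).
Hypotheses (a_gt0 : 0 < a) (a_lt : a < 2^-1).
Hypothesis def_alpha : alpha = Num.sqrt (2 * (1 - 2 * a)).
Hypothesis def_beta : beta = Num.sqrt (8 * a * (1 - 2 * a)).

Let kappa := Num.sqrt (2 * a).
Let h := cosh (beta * t).
Let k := alpha ^+ 2.
Let M := k * h.
Let N := beta * sinh (beta * t).
Let E := M ^+ 2 + N ^+ 2.
Let l := 2 * pi / alpha.

Let alpha2 : alpha ^+ 2 = 2 * (1 - 2 * a).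
Proof. by rewrite def_alpha sqr_sqrtr//; move: a_gt0 a_lt; lra. Qed.

Let beta2 : beta ^+ 2 = 8 * a * (1 - 2 * a).
Proof. by rewrite def_beta sqr_sqrtr//; move: a_gt0 a_lt; nra. Qed.

Let kappa2 : kappa ^+ 2 = 2 * a.
Proof. by rewrite sqr_sqrtr//; move: a_gt0 a_lt; lra. Qed.

Let alpha_gt0 : 0 < alpha.
Proof. by rewrite def_alpha sqrtr_gt0; move: a_gt0 a_lt; lra. Qed.

Let l_gt0 : 0 < l.
Proof. by rewrite /l divr_gt0// mulr_gt0// pi_gt0. Qed.

Let alphal : alpha * l = pi *+ 2.
Proof. by rewrite /l mulrCA divff ?gt_eqF// mulr1 mulr_natl. Qed.

Lemma cosh2Bsinh2 (x : R) : cosh x ^+ 2 - sinh x ^+ 2 = 1.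
Proof.
have e : expR x * expR (- x) = 1 by rewrite -expRD subrr expR0.
by rewrite /cosh /sinh -[RHS]e; field.
Qed.

Lemma cosh_ge1 (x : R) : 1 <= cosh x.
Proof.
have e : expR x * expR (- x) = 1 by rewrite -expRD subrr expR0.
have := sqr_ge0 (expR x - expR (- x)); have := expR_gt0 x; have := expR_gt0 (- x).
by rewrite /cosh; nra.
Qed.

(** The place where the parameters meet: [beta^2 = 2 k kappa^2] and [k^2 + beta^2 = 2 k]. *)
Let EE : E = 2 * k * (h ^+ 2 - kappa ^+ 2).
Proof.
have e := cosh2Bsinh2 (beta * t).
have -> : E = k ^+ 2 * h ^+ 2 + beta ^+ 2 * (h ^+ 2 - 1) by rewrite -e /E /M /N /h; ring.
by rewrite beta2 kappa2 /k alpha2; ring.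
Qed.

Let den x := kappa * cos (alpha * x) - h.

(** The condition [a < 1/2] gives [kappa < 1], whereas [h >= 1], so the denominator stays
    negative. *)
Let den_neq0 x : den x != 0.
Proof.
have k0 : 0 <= kappa by exact: sqrtr_ge0.
have k1 : kappa < 1 by rewrite -(@ltr_pXn2r _ 2)// ?nnegrE// kappa2 expr1n; move: a_lt; lra.
have := cosh_ge1 (beta * t); rewrite -/h => h1; have := cos_le1 (alpha * x).
move=> c1; have hc : kappa * cos (alpha * x) <= kappa.
  by rewrite -[leRHS]mulr1 ler_wpM2l.
by rewrite /den lt_eqF// subr_lt0 (le_lt_trans hc)// (lt_le_trans k1).
Qed.

Let g x := (den x)^-1.
Let g1 x := kappa * alpha * (sin (alpha * x) * (g x * g x)).

Let hg : has_deriv g g1.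
Proof.
have hd : has_deriv den (fun x => - (kappa * alpha) * sin (alpha * x)).
  have := has_deriv_add (has_deriv_scale kappa (has_deriv_cos alpha)) (has_deriv_cst (- h)).
  by congr has_deriv; apply/funext => x; ring.
have := has_deriv_inv den_neq0 hd; congr has_deriv; apply/funext => x.
by rewrite /g1 /g; ring.
Qed.

Let kcos x : kappa * cos (alpha * x) = den x + h.
Proof. by rewrite /den subrK. Qed.

Let g1_sqr x : g1 x ^+ 2 = - (E / 2) * g x ^+ 4 - 2 * M * g x ^+ 3 - k * g x ^+ 2.
Proof.
have -> : g1 x ^+ 2 = k * (kappa ^+ 2 - (kappa * cos (alpha * x)) ^+ 2) * g x ^+ 4.
  by rewrite /g1 /k exprMn [X in _ * X]exprMn sin2cos2; ring.
by rewrite kcos EE /M /g; field; rewrite den_neq0.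
Qed.

(** Computed from the explicit sine formula: differentiating the relation for [g1 ^+ 2] would
    require dividing by [g1], which vanishes wherever [sin (alpha * x)] does. *)
Let hg1 : has_deriv g1 (fun x => profile2 E M k (g x)).
Proof.
have := has_deriv_scale (kappa * alpha) (has_deriv_mul (has_deriv_sin alpha) (has_deriv_mul hg hg)).
congr has_deriv; apply/funext => x.
have -> : kappa * alpha * (alpha * cos (alpha * x) * (g x * g x) +
    sin (alpha * x) * (g1 x * g x + g x * g1 x)) =
  k * (kappa * cos (alpha * x)) * g x ^+ 2 + 2 * k * kappa ^+ 2 * sin (alpha * x) ^+ 2 * g x ^+ 3.
  by rewrite /g1 /k; ring.
have -> : 2 * k * kappa ^+ 2 * sin (alpha * x) ^+ 2 =
    2 * k * (kappa ^+ 2 - (kappa * cos (alpha * x)) ^+ 2).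
  by rewrite sin2cos2; ring.
by rewrite kcos /profile2 EE /M /g; field; rewrite den_neq0.
Qed.

(** [P + i Q] is [exp(it) (M + i N)]; the phase is absorbed here, so the breather is
    [exp(it) + (P + i Q) g]. *)
Let P := cos t * M - sin t * N.
Let Q := sin t * M + cos t * N.

Let phase : cos t ^+ 2 + sin t ^+ 2 = 1. Proof. exact: cos2Dsin2. Qed.

Let phaseM : cos t * P + sin t * Q = M.
Proof.
have -> : cos t * P + sin t * Q = (cos t ^+ 2 + sin t ^+ 2) * M by rewrite /P /Q; ring.
by rewrite phase mul1r.
Qed.

Let phaseE : P ^+ 2 + Q ^+ 2 = E.
Proof.
have -> : P ^+ 2 + Q ^+ 2 = (cos t ^+ 2 + sin t ^+ 2) * E by rewrite /P /Q /E; ring.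
by rewrite phase mul1r.
Qed.

Let p x := cos t + P * g x.
Let q x := sin t + Q * g x.
Let g2 x := profile2 E M k (g x).
Let g3 x := (- 3 * E * g x ^+ 2 - 6 * M * g x - k) * g1 x.
Let g4 x := profile4 E M k (g x) (g1 x).

Lemma breatherE : breather a alpha beta t = fun x => p x +i* q x.
Proof.
apply/funext => x; rewrite /breather -fmorphV.
by apply/complex_eqP; split; rewrite /p /q /P /Q /M /N /g /den /k /h /kappa /=; ring.
Qed.

Let hg2 : has_deriv g2 g3. Proof. exact: profile2_deriv. Qed.
Let hg3 : has_deriv g3 g4. Proof. exact: profile3_deriv. Qed.

Let elp x : euler_lagrange k (p x) (q x) (P * g1 x) (Q * g1 x) (P * g2 x) (Q * g2 x) (P * g4 x) = 0.
Proof. exact: euler_lagrange_profile. Qed.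

Let elq x : euler_lagrange k (q x) (p x) (Q * g1 x) (P * g1 x) (Q * g2 x) (P * g2 x) (Q * g4 x) = 0.
Proof. by apply: euler_lagrange_profile => //; rewrite addrC. Qed.

Let tg : test_function l g.
Proof.
have tt := trig_test alphal.
have tsin : test_function l (fun x => sin (alpha * x)).
  by have := tt _ (trig_sin alpha 1); rewrite mul1r.
apply: (@test_algebra_test _ _ g g1 _ hg) (test_algebra_gen _ _) => [x|].
  by rewrite /g /den mulrDr alphal cosD2pi.
apply: test_algebra_mul; first by apply: test_algebra_base; exact: test_cst.
by apply: test_algebra_mul; [exact: test_algebra_base|];
   apply: test_algebra_mul; exact: test_algebra_gen.
Qed.

Let taffine c C : test_function l (fun x => c + C * g x).
Proof. by apply: test_add; [exact: test_cst|exact: test_scale]. Qed.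

Lemma breather_critical : is_critical_point l (calH alpha) (breather a alpha beta t).
Proof.
rewrite breatherE.
exact: (euler_lagrange_critical_point l_gt0 (taffine _ _) (taffine _ _)
  (has_deriv_affine _ _ hg) (has_deriv_scale _ hg1) (has_deriv_scale _ hg2) (has_deriv_scale _ hg3)
  (has_deriv_affine _ _ hg) (has_deriv_scale _ hg1) (has_deriv_scale _ hg2) (has_deriv_scale _ hg3)
  elp elq).
Qed.

Lemma breather_ode x :
  let A := breather a alpha beta t in
  let A1 := cderive A in
  let A2 := cderive A1 in
  let A3 := cderive A2 in
  let A4 := cderive A3 in
  [/\ cderivable A x, cderivable A1 x, cderivable A2 x & cderivable A3 x] /\
  A4 x + 3 * A1 x ^+ 2 * conjc (A x)
  + (4 * (abs2 (A x))%:C - 3) * A2 x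
  + A x ^+ 2 * conjc (A2 x)
  + 2 * (abs2 (A1 x))%:C * A x
  + 3 / 2 * ((abs2 (A x))%:C - 1) ^+ 2 * A x
  + (alpha ^+ 2)%:C * (A2 x + ((abs2 (A x))%:C - 1) * A x) = 0.
Proof.
move=> A A1 A2 A3 A4.
have [e1 d0] := cderiveE (has_deriv_affine (cos t) P hg) (has_deriv_affine (sin t) Q hg).
have [e2 d1] := cderiveE (has_deriv_scale P hg1) (has_deriv_scale Q hg1).
have [e3 d2] := cderiveE (has_deriv_scale P hg2) (has_deriv_scale Q hg2).
have [e4 d3] := cderiveE (has_deriv_scale P hg3) (has_deriv_scale Q hg3).
rewrite /A4 /A3 /A2 /A1 /A breatherE e1 e2 e3 e4.
by split; [split|exact: euler_lagrange_complex].
Qed.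

End Breather.

Theorem theorem1p2 (R : realType) (a alpha beta : R) (A : R -> R -> R[i])
  (a_gt0 : 0 < a) (a_lt : a < 2^-1)
  (def_alpha : alpha = Num.sqrt (2 * (1 - 2 * a)))
  (def_beta : beta = Num.sqrt (8 * a * (1 - 2 * a)))
  (def_A : forall t x, A t x = breather a alpha beta t x) :
  (forall t : R, is_critical_point (2 * pi / alpha) (calH alpha) (A t)) /\
  (forall t : R,
     let A1 := cderive (A t) in
     let A2 := cderive A1 in
     let A3 := cderive A2 in
     let A4 := cderive A3 in
     forall x : R,
       [/\ cderivable (A t) x, cderivable A1 x, cderivable A2 x
         & cderivable A3 x] /\
       A4 x + 3 * A1 x ^+ 2 * conjc (A t x)
       + (4 * (abs2 (A t x))%:C - 3) * A2 x
       + A t x ^+ 2 * conjc (A2 x)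
       + 2 * (abs2 (A1 x))%:C * A t x
       + 3 / 2 * ((abs2 (A t x))%:C - 1) ^+ 2 * A t x
       + (alpha ^+ 2)%:C * (A2 x + ((abs2 (A t x))%:C - 1) * A t x) = 0).
Proof.
have eA t : A t = breather a alpha beta t by apply/funext => x; exact: def_A.
split=> t; rewrite eA; first exact: breather_critical.
by move=> A1 A2 A3 A4 x; exact: breather_ode.
Qed.
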